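(* Consider the policy optimization problem $\max_{\theta\in\mathbb{R}^d}J(\theta)$, $J(\theta)=\mathbb{E}_{\tau\sim p(\cdot|\theta)}[\mathcal{R}(\tau)]$, with trajectory gradient $g(\tau|\theta)$, and suppose the unbiasedness, boundedness and bounded-variance assumptions (A1)–(A3) listed in the context hold. Let $\epsilon>0$ and choose $$\eta=\frac1{2L},\quad m=\Big(\frac{L^2\sigma^2}{Q\epsilon}\Big)^{1/3},\quad B=\Big(\frac{Q\sigma^4}{L^2\epsilon^2}\Big)^{1/3},\quad \alpha=48,\quad \beta=6,$$ with $L$ and $Q$ the constants of the context. Then the output $\theta_\xi$ of AbaSVRPG satisfies $$\mathbb{E}\|\nabla J(\theta_\xi)\|^2\le\frac{88L}{K+1}\big(J(\theta^* )-J(\theta_0)\big)+\frac\epsilon2,$$ where $K$ denotes the total number of iterations and $\theta^*\in\arg\max_{\theta\in\mathbb{R}^d}J(\theta)$.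
   Context: Setting. A discounted MDP with state space $\mathcal{S}$, action space $\mathcal{A}$, transition model $\mathcal{P}(s'|s,a)$, reward $\mathcal{R}(s,a)\in[-R,R]$, discount $\gamma\in[0,1)$, initial state distribution $\rho$, finite horizon $H$; policies $\pi_\theta(\cdot|s)$, $\theta\in\mathbb{R}^d$. $p(\cdot|\theta)$ is the distribution of the trajectory $\tau=(s_0,a_0,\dots,s_{H-1},a_{H-1})$ under $\pi_\theta$ with $s_0\sim\rho$; $\mathcal{R}(\tau)=\sum_{t}\gamma^t\mathcal{R}(s_t,a_t)$ (sum over the time steps of the trajectory). $g(\tau|\theta)$ is a trajectory gradient: REINFORCE, $g=\big(\sum_t\gamma^t\mathcal{R}(s_t,a_t)-b(s_t,a_t)\big)\big(\sum_t\nabla\log\pi_\theta(a_t|s_t)\big)$, or G(PO)MDP, $g=\sum_t(\gamma^t\mathcal{R}(s_t,a_t)-b(s_t,a_t))\sum_{i\le t}\nabla\log\pi_\theta(a_i|s_i)$, with $b$ a bias (baseline) function. A maximizer $\theta^*$ of $J$ is assumed to exist. Assumptions. (A1) $\mathbb{E}_{\tau\sim p(\cdot|\theta)}[g(\tau|\theta)]=\nabla J(\theta)$ for all $\theta$. (A2) There are finite constants $G,C_H,R\ge0$ with $|\nabla_{\theta_i}\log\pi_\theta(a|s)|\le G$, $|\mathcal{R}(s,a)|\le R$, $|\frac{\partial^2}{\partial\theta_i\partial\theta_j}\log\pi_\theta(a|s)|\le C_H$ for all $(s,a)$, $\theta$, $1\le i,j\le d$. (A3) There is $\sigma^2<\infty$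 with $\mathbb{E}_{\tau\sim p(\cdot|\theta)}\|g(\tau|\theta)-\nabla J(\theta)\|^2\le\sigma^2$ for all $\theta\in\mathbb{R}^d$. Constants. Under (A1)–(A3) it is known from earlier work (Papini et al. 2018; Xu et al. 2019) that there exist constants $L>0$, $L_g$, $\Gamma$, $\alpha_\omega>0$ such that: $\|\nabla J(\theta_1)-\nabla J(\theta_2)\|\le L\|\theta_1-\theta_2\|$; $\|g(\tau|\theta_1)-g(\tau|\theta_2)\|\le L_g\|\theta_1-\theta_2\|$ for all $\tau$; $\|g(\tau|\theta)\|^2\le\Gamma$; and $\mathbb{E}_{\tau\sim p(\cdot|\theta_1)}\big|1-\frac{p(\tau|\theta_2)}{p(\tau|\theta_1)}\big|^2\le\alpha_\omega\|\theta_1-\theta_2\|^2$. Fix such constants and set $Q=2(L_g^2+\Gamma\alpha_\omega)$. Importance weight: $\omega(\tau|\theta_1,\theta_2)=p(\tau|\theta_2)/p(\tau|\theta_1)$. AbaSVRPG. Inputs: $\theta_0\in\mathbb{R}^d$, $\eta,\epsilon,\alpha,\beta>0$, positive integers $m,B$. For $k=0,1,\dots,K$, with $n_k=\lfloor k/m\rfloor m$: if $k\equiv0\pmod m$, draw i.i.d. $\tau_1,\dots,\tau_N\sim p(\cdot|\theta_k)$ with $N=\frac{\alpha\sigma^2}{\frac\beta m\sum_{i=n_k-m}^{n_k-1}\|v_i\|^2+\epsilon}$ (rounded up; convention $\|v_{-1}\|=\dots=\|v_{-m}\|=0$), set $v_k=\frac1N\sum_{i=1}^Ng(\tau_i|\theta_k)$,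 $\tilde\theta=\theta_k$, $\tilde v=v_k$; otherwise draw i.i.d. $\tau_1,\dots,\tau_B\sim p(\cdot|\theta_k)$ and set $v_k=\frac1B\sum_{i=1}^B\big(g(\tau_i|\theta_k)-\omega(\tau_i|\theta_k,\tilde\theta)g(\tau_i|\tilde\theta)\big)+\tilde v$. In both cases $\theta_{k+1}=\theta_k+\eta v_k$. Output: $\theta_\xi$ uniformly at random from $\{\theta_0,\dots,\theta_K\}$. When prescribed values are not integers, $m$ is rounded down (but at least $1$) and $B$ is rounded up. *)

(* Defs.v *)
From HB Require Import structures.
From mathcomp Require Import all_boot all_order all_algebra.
From mathcomp Require Import all_classical all_reals all_analysis.
From mathcomp Require Import measurable_realfun.

Set Implicit Arguments.
Unset Strict Implicit.
Unset Printing Implicit Defensive.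

Import Order.TTheory GRing.Theory Num.Theory.
Import numFieldNormedType.Exports.

Local Open Scope classical_set_scope.
Local Open Scope ring_scope.

Section euclidean.
Context {R : realType} {d : nat}.
Implicit Types (f : 'rV[R]_d -> R) (x : 'rV[R]_d).

(* The library norm on 'rV[R]_d is the sup norm, hence this definition. *)
Definition enorm x : R := Num.sqrt (\sum_(i < d) x 0 i ^+ 2).

Definition partial (i : 'I_d) f x : R := 'D_(delta_mx 0 i) (f : _ -> R^o) x.

Definition has_partial (i : 'I_d) f x : Prop :=
  derivable (f : _ -> R^o) x (delta_mx 0 i).

Definition grad f x : 'rV[R]_d := \row_i partial i f x.

End euclidean.

Section kernel_complements.
Context d1 d2 d3 (X : measurableType d1) (Y : measurableType d2)
  (Z : measurableType d3) (R : realType).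

Section composition.
Variables (l : R.-pker X ~> Y) (k : R.-pker (X * Y) ~> Z).

Let mkcomp_prob x : (mkcomp l k) x setT = 1%E.
Proof.
transitivity (\int[l x]_y k (x, y) setT)%E; first by [].
under eq_integral do rewrite prob_kernel.
by rewrite integral_cst// mul1e prob_kernel.
Qed.

HB.instance Definition _ :=
  Kernel_isProbability.Build _ _ X Z R (mkcomp l k) mkcomp_prob.

End composition.

Section weakening.
Variable k : R.-pker Y ~> Z.

Definition kweaken (xy : X * Y) : {measure set Z -> \bar R} := k xy.2.

Let measurable_kweaken U : measurable U ->
  measurable_fun [set: X * Y] (kweaken ^~ U : X * Y -> \bar R).
Proof.
by move=> mU; apply: (measurableT_comp (measurable_kernel k U mU)).
Qed.

HB.instance Definition _ :=
  isKernel.Build _ _ (X * Y)%type Z R kweaken measurable_kweaken.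

Let kweaken_prob xy : kweaken xy setT = 1%E.
Proof. by rewrite /kweaken prob_kernel. Qed.

HB.instance Definition _ :=
  Kernel_isProbability.Build _ _ (X * Y)%type Z R kweaken kweaken_prob.

End weakening.

Section mixture.
Variables (P : probability X R) (k : R.-pker X ~> Y).

Definition kmix (U : set Y) : \bar R := (\int[P]_x k x U)%E.

Let kmix0 : kmix set0 = 0%E.
Proof. by rewrite /kmix; apply: integral0_eq => x _; rewrite measure0. Qed.

Let kmix_ge0 U : (0 <= kmix U)%E.
Proof. by apply: integral_ge0 => x _; exact: measure_ge0. Qed.

Let kmix_sigma_additive : semi_sigma_additive kmix.
Proof.
move=> F mF tF mUF; rewrite [X in _ --> X](_ : _ =
  (\int[P]_x (\sum_(n <oo) k x (F n)))%E).
  rewrite integral_nneseries//; last by move=> n; exact: measurable_kernel.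
  by apply: is_cvg_ereal_nneg_natsum => n _; exact: kmix_ge0.
by apply: eq_integral => x _; apply/esym/cvg_lim => //;
  exact: measure_semi_sigma_additive.
Qed.

HB.instance Definition _ :=
  isMeasure.Build _ _ _ kmix kmix0 kmix_ge0 kmix_sigma_additive.

Let kmix_prob : kmix setT = 1%E.
Proof.
rewrite /kmix; under eq_integral do rewrite prob_kernel.
rewrite integral_cst// mul1e; exact: probability_setT.
Qed.

HB.instance Definition _ := Measure_isProbability.Build _ _ _ kmix kmix_prob.

End mixture.
End kernel_complements.

Section mdp.
Context d1 d2 (S : measurableType d1) (A : measurableType d2) (R : realType).

Record mdp := Mdp {
  transition : R.-pker (S * A) ~> S;
  reward : S * A -> R;
  discount : R;
  init : probability S R;
  horizon : nat;
  measurable_reward : measurable_fun setT reward;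
  discount_ge0 : 0 <= discount;
  discount_lt1 : discount < 1 }.

(* [policy_pdf theta (s, a)] is pi_theta(a|s), a density with respect to a     *)
(* reference measure on actions (counting measure, Lebesgue measure, ...).    *)
(* It is positive because log pi_theta(a|s) is required to exist for all      *)
(* theta, s and a.                                                            *)
Record policy (d : nat) := Policy {
  policy_ker : 'rV[R]_d -> R.-pker S ~> A;
  policy_ref : {sigma_finite_measure set A -> \bar R};
  policy_pdf : 'rV[R]_d -> S * A -> R;
  policy_pdf_gt0 : forall theta x, 0 < policy_pdf theta x;
  measurable_policy_pdf : forall theta, measurable_fun setT (policy_pdf theta);
  policy_kerE : forall theta s B, measurable B ->
    policy_ker theta s B =
      (\int[policy_ref]_(a in B) (policy_pdf theta (s, a))%:E)%E }.

End mdp.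

Section trajectories.
Context d1 d2 (S : measurableType d1) (A : measurableType d2) (R : realType).
Variables (M : mdp S A R) (d : nat) (pi : policy S A R d).
Implicit Types theta : 'rV[R]_d.

Local Notation H := (horizon M).

Definition traj := (horizon M).-tuple (S * A).

Section step.
Variables (theta : 'rV[R]_d) (n : nat).

Definition traj_cons (y : ((S * A) * S) * n.-tuple (S * A)) :
  n.+1.-tuple (S * A) := [tuple of y.1.1 :: y.2].

Lemma measurable_traj_cons : measurable_fun setT traj_cons.
Proof.
apply: measurable_cons; last exact: measurable_snd.
exact: (measurableT_comp measurable_fst measurable_fst).
Qed.

End step.

(* From state s: draw a ~ pi_theta(.|s), then s' ~ P(.|s, a), then the         *)
(* remaining n steps from s', and put (s, a) in front of them. The state      *)
(* reached after the last action is integrated out.                           *)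
Fixpoint traj_ker theta (n : nat) : R.-pker S ~> n.-tuple (S * A) :=
  match n with
  | 0 => kdirac (@measurable_cst _ _ S (0.-tuple (S * A)) setT [tuple])
  | n'.+1 => mkcomp (policy_ker pi theta)
      (mkcomp (transition M)
        (mkcomp (kweaken (traj_ker theta n'))
          (kdirac (@measurable_traj_cons n'))))
  end.

(* p(.|theta) *)
Definition traj_law theta : probability traj R :=
  kmix (init M) (traj_ker theta H).

(* Density of p(.|theta) with respect to the measure                          *)
(* rho(ds_0) mu(da_0) P(ds_1|s_0,a_0) mu(da_1) ... , mu = policy_ref pi, which *)
(* does not depend on theta; the factors rho and P of the usual product       *)
(* formula for p(tau|theta) cancel in likelihood ratios.                      *)
Definition likelihood theta (tau : traj) : R :=
  \prod_(t < H) policy_pdf pi theta (tnth tau t).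

(* omega(tau|theta1, theta2) = p(tau|theta2) / p(tau|theta1) *)
Definition importance_weight (tau : traj) theta1 theta2 : R :=
  likelihood theta2 tau / likelihood theta1 tau.

Definition traj_return (tau : traj) : R :=
  \sum_(t < H) discount M ^+ t * reward M (tnth tau t).

Definition objective theta : R := fine 'E_(traj_law theta)[traj_return].

Definition logpdf (x : S * A) theta : R := ln (policy_pdf pi theta x).

Definition score theta (x : S * A) : 'rV[R]_d := grad (logpdf x) theta.

Inductive estimator := Reinforce | Gpomdp.

Variables (e : estimator) (b : S * A -> R).

Definition traj_grad (tau : traj) theta : 'rV[R]_d :=
  let r (t : 'I_H) :=
    discount M ^+ t * reward M (tnth tau t) - b (tnth tau t) in
  match e with
  | Reinforce =>
      (\sum_(t < H) r t) *: \sum_(t < H) score theta (tnth tau t)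
  | Gpomdp =>
      \sum_(t < H) r t *: \sum_(i < H | (i <= t)%N) score theta (tnth tau i)
  end.

Definition unbiased : Prop :=
  (forall theta, differentiable (objective : _ -> R^o) theta) /\
  forall theta (i : 'I_d),
    ('E_(traj_law theta)[fun tau => (traj_grad tau theta 0 i)%R] =
     (grad objective theta 0 i)%:E)%E.

Definition bounded_log_derivatives : Prop :=
  exists G CH Rmax : R,
    [/\ 0 <= G, 0 <= CH & 0 <= Rmax] /\
    [/\ forall theta x i,
          has_partial i (logpdf x) theta /\
          `|partial i (logpdf x) theta| <= G,
        forall x, `|reward M x| <= Rmax &
        forall theta x i j,
          has_partial i (partial j (logpdf x)) theta /\
          `|partial i (partial j (logpdf x)) theta| <= CH].

Definition bounded_variance (sigma : R) : Prop :=
  forall theta,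
    ('E_(traj_law theta)[fun tau =>
        (enorm (traj_grad tau theta - grad objective theta) ^+ 2)%R]
     <= (sigma ^+ 2)%:E)%E.

Definition grad_lipschitz (L : R) : Prop :=
  forall theta1 theta2,
    enorm (grad objective theta1 - grad objective theta2)
    <= L * enorm (theta1 - theta2).

Definition traj_grad_lipschitz (Lg : R) : Prop :=
  forall tau theta1 theta2,
    enorm (traj_grad tau theta1 - traj_grad tau theta2)
    <= Lg * enorm (theta1 - theta2).

Definition traj_grad_bounded (Gamma : R) : Prop :=
  forall tau theta, enorm (traj_grad tau theta) ^+ 2 <= Gamma.

Definition weight_lipschitz (alpha_w : R) : Prop :=
  forall theta1 theta2,
    ('E_(traj_law theta1)[fun tau =>
        (`|1 - importance_weight tau theta1 theta2| ^+ 2)%R]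
     <= (alpha_w * enorm (theta1 - theta2) ^+ 2)%:E)%E.

End trajectories.

Section algorithm.
Context d1 d2 (S : measurableType d1) (A : measurableType d2) (R : realType).
Variables (M : mdp S A R) (d : nat) (pi : policy S A R d).
Variables (e : estimator) (b : S * A -> R).
Variables (sigma eta eps alpha beta : R) (m B K : nat) (theta0 : 'rV[R]_d).
Context d3 (Omega : measurableType d3) (P : probability Omega R).
(* [theta k], [v k] are the k-th iterate and update direction, [tau k i] is   *)
(* the i-th trajectory drawn at iteration k (i counted from 0).               *)
Variables (theta v : nat -> Omega -> 'rV[R]_d).
Variable tau : nat -> nat -> Omega -> traj M.

(* n_k: the snapshot and its gradient estimate in force at iteration k are    *)
(* [theta (checkpoint k)] and [v (checkpoint k)].                             *)
Definition checkpoint (k : nat) : nat := (k %/ m * m)%N.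

(* With truncated subtraction the sum is empty for n_k = 0, in accordance     *)
(* with the convention v_{-1} = ... = v_{-m} = 0. At least one trajectory is  *)
(* drawn, which matters only for sigma = 0.                                   *)
Definition adaptive_batch (k : nat) (w : Omega) : nat :=
  maxn 1 `|Num.ceil (alpha * sigma ^+ 2 /
    (beta / m%:R *
       \sum_(checkpoint k - m <= i < checkpoint k) enorm (v i w) ^+ 2
     + eps))|%N.

Definition batch (k : nat) (w : Omega) : nat :=
  if (m %| k)%N then adaptive_batch k w else B.

Definition past (k : nat) : set (set Omega) :=
  <<s [set E | exists j i U,
         [/\ (j < k)%N, measurable U & E = tau j i @^-1` U]] >>.

(* [run_sample]: conditionally on the past, the trajectories drawn at         *)
(* iteration k are i.i.d. with law p(.|theta_k). The values           *)
(* [tau k i w] with i >= batch k w, which are not drawn, are arbitrary.       *)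
Record abasvrpg_run : Prop := AbasvrpgRun {
  run_measurable : forall k i, measurable_fun setT (tau k i);
  run_sample : forall k n (E : set Omega) (U : 'I_n -> set (traj M)),
    (k <= K)%N -> past k E -> E `<=` [set w | batch k w = n] ->
    (forall i, measurable (U i)) ->
    P (E `&` \bigcap_(i in [set: 'I_n]) tau k i @^-1` U i) =
    (\int[P]_(w in E)
       (\prod_(i < n) fine (traj_law M pi (theta k w) (U i)))%:E)%E;
  run_init : forall w, theta 0%N w = theta0;
  run_checkpoint : forall k w, (k <= K)%N -> (m %| k)%N ->
    v k w = (adaptive_batch k w)%:R^-1 *:
      \sum_(i < adaptive_batch k w) traj_grad pi e b (tau k i w) (theta k w);
  run_inner : forall k w, (k <= K)%N -> ~~ (m %| k)%N ->
    let snap := theta (checkpoint k) w in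
    v k w = B%:R^-1 *:
      \sum_(i < B) (traj_grad pi e b (tau k i w) (theta k w) -
        importance_weight pi (tau k i w) (theta k w) snap *:
          traj_grad pi e b (tau k i w) snap)
      + v (checkpoint k) w;
  run_update : forall k w, (k <= K)%N ->
    theta k.+1 w = theta k w + eta *: v k w }.

(* The output index is uniform on {0, ..., K} and independent of the run.     *)
Definition uniform_output (xi : Omega -> nat) : Prop :=
  [/\ measurable_fun setT xi,
      forall w, (xi w <= K)%N &
      forall k E, (k <= K)%N -> past K.+1 E ->
        P (E `&` xi @^-1` [set k]) = (P E * (K.+1%:R^-1)%:E)%E].

End algorithm.

Section parameters.
Context {R : realType}.
Variables (L Lg Gamma alpha_w sigma eps : R).

Definition Qconst : R := 2 * (Lg ^+ 2 + Gamma * alpha_w).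

Definition epoch_length : nat :=
  maxn 1 (Num.truncn ((L ^+ 2 * sigma ^+ 2 / (Qconst * eps)) `^ (1 / 3))).

Definition inner_batch : nat :=
  maxn 1 `|Num.ceil ((Qconst * sigma ^+ 4 / (L ^+ 2 * eps ^+ 2)) `^ (1 / 3))|%N.

End parameters.

(* Main.v *)
Require Import Defs.
From HB Require Import structures.
From mathcomp Require Import all_boot all_order all_algebra.
From mathcomp Require Import all_classical all_reals all_analysis.
From mathcomp Require Import measurable_realfun.
From mathcomp Require Import ring lra.

Set Implicit Arguments.
Unset Strict Implicit.
Unset Printing Implicit Defensive.

Import Order.TTheory GRing.Theory Num.Theory.
Import numFieldNormedType.Exports.

Local Open Scope classical_set_scope.
Local Open Scope ring_scope.

(** Write [e_k = v_k - grad J(theta_k)] for the error of the update direction.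
    The gradient of [J] is [L]-Lipschitz, so with [eta = 1/(2L)] each update
    satisfies pointwise
      [eta/4 |v_k|^2 <= J(theta_{k+1}) - J(theta_k) + eta/2 |e_k|^2]
    ([ascent_step]). This telescopes to
      [eta/4 V <= J(theta* ) - J(theta_0) + eta/2 D], where
      [V = sum_k E|v_k|^2] and [D = sum_k E|e_k|^2] ([sum_mean_sqr_dir_le]).
    It remains to bound [D] by a fraction of [V], after which
    [|grad J(theta_k)|^2 <= 2|v_k|^2 + 2|e_k|^2] gives the claim.

    Conditionally on the past, a direction is an average of [n] i.i.d. centered
    vectors plus a quantity determined by the past; by orthogonality the squared
    error is the variance of one sample divided by [n] plus the squared error
    inherited from the past ([conditional_variance_le]).
    - At a checkpoint nothing is inherited, the variance is at most [sigma^2],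
      and the adaptive batch size turns [sigma^2/n] into
      [(beta/m * (sum of |v_i|^2 over the previous epoch) + eps) / alpha]
      ([checkpoint_error]).
    - Otherwise the error of the checkpoint is inherited, and a sample
      [g(theta_k) - w g(snapshot)] has mean
      [grad J(theta_k) - grad J(snapshot)] by importance sampling
      ([mean_weighted_traj_grad]) and second moment at most
      [Q |theta_k - snapshot|^2] ([weighted_difference_moment]). That distance is
      at most [eta^2 m] times the sum of the [|v_i|^2] since the checkpoint
      ([inner_error], [sqr_drift_le]).
    Summed over [k], each [|v_i|^2] is counted at most [m] times in each of the
    two ways ([epoch_sum_le]), so
      [D <= (eta^2 Q m^2 / B + beta/alpha) V + (K+1) eps/alpha].
    The choice of [m] and [B] makes [Q m^2 <= L^2 B] ([epoch_length_sqr_le]), the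
    first coefficient is at most [1/4 + 1/8 = 3/8], and [V] is absorbed on the
    left: [V <= 32 L (J(theta* ) - J(theta_0)) + (K+1) eps/6]. Absorbing requires
    [V] to be finite ([second_moments_finite]).

    Conditional expectations are replaced by a freezing lemma
    ([ge0_integral_freeze]): a function of the past and of a sample is integrated
    by integrating first over the conditional law of the sample. This needs joint
    measurability in the parameter and the trajectory, which follows from
    Lipschitz continuity in the parameter ([measurable_caratheodory]); the laws
    [p(.|theta)] depend measurably on [theta] because they have densities with
    respect to each other ([ge0_integral_traj_law]). *)

(** * Euclidean norm and smooth ascent *)

Section euclidean_norm.
Context {R : realType} {d : nat}.
Implicit Types x y : 'rV[R]_d.

Lemma enorm_ge0 x : 0 <= enorm x.
Proof. exact: sqrtr_ge0. Qed.

Lemma sqr_enorm x : enorm x ^+ 2 = \sum_(i < d) x 0 i ^+ 2.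
Proof. by rewrite sqr_sqrtr// sumr_ge0// => i _; rewrite sqr_ge0. Qed.

Lemma coordB x y i : (x - y) 0 i = x 0 i - y 0 i.
Proof. by rewrite !mxE. Qed.

Lemma coordZ a x i : (a *: x) 0 i = a * x 0 i.
Proof. by rewrite mxE. Qed.

Lemma coord_le_enorm x i : `|x 0 i| <= enorm x.
Proof.
rewrite -sqrtr_sqr ler_wsqrtr// (bigD1 i)//= lerDl sumr_ge0// => j _.
exact: sqr_ge0.
Qed.

Lemma enorm_le_l1 x : enorm x <= \sum_(i < d) `|x 0 i|.
Proof.
have s0 : 0 <= \sum_(i < d) `|x 0 i| by rewrite sumr_ge0.
rewrite -(ler_pXn2r (ltn0Sn 1)) ?nnegrE ?enorm_ge0// sqr_enorm.
rewrite [leRHS]expr2 mulr_suml ler_sum// => i _.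
rewrite -real_normK ?num_real// expr2 ler_wpM2l//.
by rewrite (bigD1 i)//= lerDl sumr_ge0.
Qed.

Lemma enorm0_sqr : enorm (0 : 'rV[R]_d) ^+ 2 = 0.
Proof. by rewrite sqr_enorm big1// => i _; rewrite mxE expr0n. Qed.

Lemma sqr_enormZ a x : enorm (a *: x) ^+ 2 = a ^+ 2 * enorm x ^+ 2.
Proof.
by rewrite !sqr_enorm mulr_sumr; apply: eq_bigr => i _; rewrite mxE exprMn.
Qed.

Lemma sqr_enormD_le x y : enorm (x + y) ^+ 2 <= 2 * enorm x ^+ 2 + 2 * enorm y ^+ 2.
Proof.
rewrite !sqr_enorm !mulr_sumr -big_split/= ler_sum// => i _.
rewrite mxE -subr_ge0.
have -> : 2 * x 0 i ^+ 2 + 2 * y 0 i ^+ 2 - (x 0 i + y 0 i) ^+ 2 =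
   (x 0 i - y 0 i) ^+ 2 by ring.
exact: sqr_ge0.
Qed.

Lemma sqr_sum_le (I : Type) (s : seq I) (a : I -> R) :
  (\sum_(i <- s) a i) ^+ 2 <= (size s)%:R * \sum_(i <- s) a i ^+ 2.
Proof.
elim: s => [|h t ih]; first by rewrite !big_nil expr0n mulr0.
rewrite !big_cons/=; set S := \sum_(i <- t) a i in ih *.
set T := \sum_(i <- t) a i ^+ 2 in ih *.
have T0 : 0 <= T by rewrite sumr_ge0// => i _; rewrite sqr_ge0.
case: t @S @T ih T0 => [|u t] S T ih T0.
  by rewrite /S /T !big_nil !addr0 mul1r.
set n : R := (size (u :: t))%:R in ih *.
have n1 : 1 <= n by rewrite ler1n.
have -> : (size (u :: t)).+1%:R = n + 1 by rewrite natr1.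
have n0 : 0 < n by rewrite (lt_le_trans ltr01).
have : 2 * a h * S <= n * a h ^+ 2 + T.
  rewrite -(ler_pM2l n0).
  have := sqr_ge0 (n * a h - S); nra.
nra.
Qed.

Lemma sqr_enorm_sum_le (I : Type) (s : seq I) (x : I -> 'rV[R]_d) :
  enorm (\sum_(i <- s) x i) ^+ 2 <= (size s)%:R * \sum_(i <- s) enorm (x i) ^+ 2.
Proof.
rewrite sqr_enorm.
under [X in _ * X]eq_bigr do rewrite sqr_enorm.
rewrite exchange_big/= mulr_sumr ler_sum// => j _.
by rewrite summxE; exact: sqr_sum_le.
Qed.

End euclidean_norm.

Section line_derivatives.
Context {R : realType} {d : nat}.
Implicit Types (f : 'rV[R]_d -> R) (x u : 'rV[R]_d).

Lemma is_derive_line f x u (t df : R) :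
  is_derive (x + t *: u) u (f : _ -> R^o) df ->
  is_derive t 1 (fun s : R => f (x + s *: u) : R^o) df.
Proof.
move=> [dr dE]; have E : (fun h : R => h^-1 *: (((fun s : R => f (x + s *: u) : R^o) \o shift t) (h *: (1 : R^o)) - f (x + t *: u) : R^o)) =
    (fun h : R => h^-1 *: (((f : _ -> R^o) \o shift (x + t *: u)) (h *: u) - f (x + t *: u) : R^o)).
  apply/funext => h /=; congr (_ *: (f _ - _)).
  by rewrite scalerDl addrCA; congr (_ + _); rewrite /GRing.scale/= mulr1.
split; first by rewrite /derivable E.
by rewrite -dE /derive E.
Qed.

(** The mean value theorem along a line needs nothing but directional
    derivatives, so it applies to functions that only have partials. *)
Lemma line_lipschitz f x u (C : R) (df : R -> R) (h : R) :
  (forall t : R, is_derive (x + t *: u) u (f : _ -> R^o) (df t)) ->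
  (forall t, `|df t| <= C) -> `|f (x + h *: u) - f x| <= C * `|h|.
Proof.
move=> fd dfC.
have fd1 (t : R) := is_derive_line (fd t).
have fc (A : set R) : {within A, continuous (fun s : R => f (x + s *: u))}.
  apply: continuous_subspaceT => t.
  by apply: differentiable_continuous; apply/derivable1_diffP; case: (fd1 t).
have [h0|/ltW h0] := leP 0 h.
- have [c _] := MVT_segment h0 (fun t _ => fd1 t) (fc _).
  by rewrite scale0r addr0 subr0 => ->; rewrite normrM ler_wpM2r.
- have [c _] := MVT_segment h0 (fun t _ => fd1 t) (fc _).
  by rewrite scale0r addr0 sub0r distrC => ->; rewrite normrM normrN ler_wpM2r.
Qed.

Lemma is_derive_grad f x u : differentiable (f : _ -> R^o) x ->
  is_derive x u (f : _ -> R^o) (\sum_(i < d) grad f x 0 i * u 0 i).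
Proof.
move=> fx; apply: DeriveDef; first exact: diff_derivable.
rewrite deriveE// {1}(row_sum_delta u) linear_sum/=; apply: eq_bigr => i _.
by rewrite linearZ/= /grad mxE /partial deriveE// mulrC.
Qed.

(** Along the segment from [x] to [x + u], the derivative of
    [t |-> f (x + t u) - t <grad f x, u> + L t^2 |u|^2 / 2] is nonnegative. *)
Lemma smooth_ascent f (L : R) x u : 0 <= L ->
  (forall y, differentiable (f : _ -> R^o) y) ->
  (forall y z, enorm (grad f y - grad f z) <= L * enorm (y - z)) ->
  f x + \sum_(i < d) grad f x 0 i * u 0 i - L / 2 * enorm u ^+ 2 <= f (x + u).
Proof.
move=> L0 fd fL.
pose D := \sum_(i < d) grad f x 0 i * u 0 i.
pose psi := (fun s : R => f (x + s *: u)) + (fun s => s * (- D))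
   + (fun s : R => s ^+ 2 * (L / 2 * enorm u ^+ 2)).
pose dpsi (t : R) := \sum_(i < d) grad f (x + t *: u) 0 i * u 0 i - D +
   t * L * enorm u ^+ 2.
have psid t : is_derive t (1:R) (psi : R -> R^o) (dpsi t).
  have d1 := is_derive_line (is_derive_grad u (fd (x + t *: u))).
  rewrite /psi.
  have -> : (fun s : R => s * - D) = (- D) \*: (id : R -> R^o).
    by apply/funext => s /=; rewrite mulrC.
  have -> : (fun s : R => s ^+ 2 * (L / 2 * enorm u ^+ 2)) =
    (L / 2 * enorm u ^+ 2) \*: ((id : R -> R^o) ^+ 2).
    by apply/funext => s /=; rewrite mulrC.
  apply: is_derive_eq.
  rewrite /dpsi /GRing.scale/= !mulr1 expr1.
  rewrite -!addrA; congr (_ + (_ + _)).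
  by rewrite mulrC -mulr_natr; field.
have dpsi0 t : 0 <= t -> 0 <= dpsi t.
  move=> t0; rewrite /dpsi /D -sumrB.
  suff : `|\sum_(i < d) (grad f (x + t *: u) 0 i * u 0 i - grad f x 0 i * u 0 i)|
     <= t * L * enorm u ^+ 2.
    by rewrite ler_norml => /andP[+ _]; rewrite -lerBlDr sub0r.
  pose w := grad f (x + t *: u) - grad f x.
  have wL : enorm w <= t * L * enorm u.
    apply: (le_trans (fL _ _)).
    rewrite addrC addKr -mulrA mulrCA ler_wpM2l//.
    rewrite -(ler_pXn2r (ltn0Sn 1)) ?nnegrE ?enorm_ge0//.
      by rewrite sqr_enormZ exprMn.
    by rewrite mulr_ge0// enorm_ge0.
  have -> : \sum_(i < d) (grad f (x + t *: u) 0 i * u 0 i - grad f x 0 i * u 0 i) =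
     \sum_(i < d) w 0 i * u 0 i.
    by apply: eq_bigr => i _; rewrite /w !mxE mulrBl.
  (* Cauchy-Schwarz, through [2 a b <= a^2 / s + s b^2] with [s = t L]; the
     degenerate cases [u = 0] and [s = 0] are separate. *)
  have tL0 : 0 <= t * L by rewrite mulr_ge0.
  have r0 : 0 <= t * L * enorm u ^+ 2 by rewrite mulr_ge0// sqr_ge0.
  have [u0|un0] := eqVneq (enorm u) 0.
    rewrite big1 ?normr0// => i _.
    have := coord_le_enorm u i; rewrite u0 normr_le0 => /eqP ->.
    by rewrite mulr0.
  have up : 0 < enorm u by rewrite lt_def un0 enorm_ge0.
  have [tL|tLn] := eqVneq (t * L) 0.
    rewrite big1 ?normr0// => i _.
    have := coord_le_enorm w i; move: wL; rewrite tL mul0r => wL wi.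
    have := le_trans wi wL; rewrite normr_le0 => /eqP ->.
    by rewrite mul0r.
  have tLp : 0 < t * L by rewrite lt_def tLn.
  apply: (le_trans (ler_norm_sum _ _ _)).
  apply: (@le_trans _ _ (\sum_(i < d) (w 0 i ^+ 2 / (2 * (t * L)) + t * L * u 0 i ^+ 2 / 2))).
    rewrite ler_sum// => i _.
    rewrite normrM -(@real_normK _ (w 0 i)) ?num_real// -(@real_normK _ (u 0 i)) ?num_real//.
    move: `|w 0 i| `|u 0 i| => a b.
    rewrite -(ler_pM2l (mulr_gt0 (ltr0n _ 2) tLp)) -subr_ge0.
    have -> : 2 * (t * L) * (a ^+ 2 / (2 * (t * L)) + t * L * b ^+ 2 / 2) - 2 * (t * L) * (a * b) = (a - t * L * b) ^+ 2.
      by field; move: tLn; rewrite mulf_eq0 negb_or => /andP[-> ->].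
    exact: sqr_ge0.
  rewrite big_split/= -!mulr_suml -mulr_sumr -!sqr_enorm.
  have : enorm w ^+ 2 <= (t * L) ^+ 2 * enorm u ^+ 2.
    by rewrite -exprMn ler_pXn2r// ?nnegrE ?enorm_ge0// mulr_ge0// enorm_ge0.
  rewrite -(ler_pM2r (_ : 0 < (2 * (t * L))^-1)); last by rewrite invr_gt0 mulr_gt0.
  move=> h; apply: (le_trans (lerD h (lexx _))).
  rewrite le_eqVlt; apply/orP; left; apply/eqP; field.
  by move: tLn; rewrite mulf_eq0 negb_or => /andP[-> ->].
have psic : {within `[0, 1], continuous (psi : R -> R^o)}.
  apply: continuous_subspaceT => t.
  by apply: differentiable_continuous; apply/derivable1_diffP; case: (psid t).
have [c c01] := MVT_segment ler01 (fun t _ => psid t) psic.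
rewrite subr0 mulr1 => /eqP; rewrite subr_eq => /eqP.
have -> : psi 1 = f (x + u) - D + L / 2 * enorm u ^+ 2.
  by rewrite /psi !fctE scale1r !expr1n !mul1r.
have -> : psi 0 = f x by rewrite /psi !fctE scale0r expr0n !mul0r !addr0.
have : 0 <= dpsi c by apply: dpsi0; move: c01; rewrite in_itv/= => /andP[].
rewrite -/D; lra.
Qed.

Definition l1 x := \sum_(i < d) `|x 0 i|.

(** Moving the coordinates one at a time reduces to the one-dimensional mean
    value theorem; no differentiability beyond the partials is used. *)
Lemma partial_lipschitz f (C : R) :
  (forall x i, has_partial i f x /\ `|partial i f x| <= C) ->
  forall x y, `|f x - f y| <= C * l1 (x - y).
Proof.
move=> fC x y.
have coord i z (h : R) : `|f (z + h *: delta_mx 0 i) - f z| <= C * `|h|.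
  apply: (@line_lipschitz _ _ _ _ (fun t => partial i f (z + t *: delta_mx 0 i))) => t.
    by apply: derivableP; have [] := fC (z + t *: delta_mx 0 i) i.
  by have [] := fC (z + t *: delta_mx 0 i) i.
rewrite /l1 mulr_sumr.
rewrite -{1}(subrK y x) (addrC _ y); set u := x - y.
rewrite {1}(row_sum_delta u).
elim: (index_enum _) => [|i s ih]; first by rewrite !big_nil addr0 subrr normr0.
rewrite !big_cons addrA (addrAC y).
set z := y + _ in ih *.
rewrite -(subrK (f z) (f _)) -addrA (le_trans (ler_normD _ _))// lerD//.
Qed.

End line_derivatives.

(** * Measurability *)

Section countable_selection.
Context d1 d2 (X : measurableType d1) (Y : measurableType d2).

(** Functions that depend on a random index, such as an average over a random
    number of samples, are measurable as soon as the index is discrete. *)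
Lemma measurable_select (I : countType) (N : X -> I) (F : I -> X -> Y) :
  (forall i, measurable (N @^-1` [set i])) ->
  (forall i, measurable_fun setT (F i)) ->
  measurable_fun setT (fun x => F (N x) x).
Proof.
move=> mN mF _ U mU; rewrite setTI.
have -> : (fun x => F (N x) x) @^-1` U =
    \bigcup_i (N @^-1` [set i] `&` F i @^-1` U).
  apply/seteqP; split => [x Ux|x [i _ [/= <-]]//].
  by exists (N x).
apply: countable_bigcupT_measurable => [|i]; first exact: countableP.
by apply: measurableI => //; rewrite -[_ @^-1` _]setTI; exact: mF.
Qed.

End countable_selection.

Section caratheodory.
Context d1 (X : measurableType d1) (R : realType) (d : nat).

Definition measurable_rV (th : X -> 'rV[R]_d) :=
  forall i, measurable_fun setT (fun w => th w 0 i).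

Lemma measurable_floor_eq (f : X -> R) (z : int) : measurable_fun setT f ->
  measurable ((fun x => Num.floor (f x)) @^-1` [set z]).
Proof.
move=> mf.
have -> : (fun x => Num.floor (f x)) @^-1` [set z] =
    setT `&` f @^-1` [set` `[z%:~R, (z + 1)%:~R[%R].
  rewrite setTI; apply/seteqP; split => x /=.
    by move=> /eqP; rewrite floor_eq in_itv.
  by rewrite in_itv/= -floor_eq => /eqP.
exact: mf.
Qed.

Definition grid (n : nat) (x : 'rV[R]_d) : 'rV[int]_d :=
  \row_i Num.floor (x 0 i * n.+1%:R).

Definition ungrid (n : nat) (q : 'rV[int]_d) : 'rV[R]_d :=
  \row_i ((q 0 i)%:~R / n.+1%:R).

Lemma grid_dist n x : l1 (ungrid n (grid n x) - x) <= d%:R / n.+1%:R.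
Proof.
rewrite /l1 -[d in d%:R]card_ord -sum1_card natr_sum mulr_suml ler_sum// => i _.
rewrite !mxE.
have n0 : (0 : R) < n.+1%:R by rewrite ltr0n.
have -> : (Num.floor (x 0 i * n.+1%:R))%:~R / n.+1%:R - x 0 i =
   ((Num.floor (x 0 i * n.+1%:R))%:~R - x 0 i * n.+1%:R) / n.+1%:R.
  by field; rewrite addrC natr1 gt_eqF.
rewrite normrM (gtr0_norm (x := _^-1)) ?invr_gt0// ler_pM2r ?invr_gt0//.
have /andP[] := floor_itv (x 0 i * n.+1%:R).
rewrite intrD/= => h1 h2.
by rewrite ler_norml; apply/andP; split; lra.
Qed.

(** A function that is measurable in [t] and Lipschitz in the vector is jointly
    measurable: rounding the vector to a grid of mesh [1/(n+1)] leaves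
    countably many values, and the error vanishes as [n] grows. *)
Lemma measurable_caratheodory d2 (T : measurableType d2)
    (f : T -> 'rV[R]_d -> R) (C : R) (tau : X -> T) (th : X -> 'rV[R]_d) :
  (forall x, measurable_fun setT (f ^~ x)) ->
  (forall t x y, `|f t x - f t y| <= C * l1 (x - y)) ->
  measurable_fun setT tau -> measurable_rV th ->
  measurable_fun setT (fun w => f (tau w) (th w)).
Proof.
move=> mf fC mtau mth.
apply: (@measurable_fun_cvg _ _ _ _ (fun n w => f (tau w) (ungrid n (grid n (th w))))).
  move=> n; apply: (@measurable_select _ _ X _ _ (fun w => grid n (th w))
    (fun q w => f (tau w) (ungrid n q))) => q; last exact: measurableT_comp (mf _) mtau.
  have -> : (fun w => grid n (th w)) @^-1` [set q] =
      \bigcap_(i in [set: 'I_d])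
        (fun w => Num.floor (th w 0 i * n.+1%:R)) @^-1` [set q 0 i].
    apply/seteqP; split => w /=.
      by move=> <- i _ /=; rewrite mxE.
    by move=> h; apply/rowP => i; rewrite mxE; exact: h.
  apply: fin_bigcap_measurable => // i _; apply: measurable_floor_eq.
  by apply: measurable_funM.
move=> w _.
apply/cvgrPdist_le => e e0.
near=> n.
rewrite distrC; apply: (le_trans (fC _ _ _)).
have C1 : C <= `|C| + 1 by rewrite ler_wpDr// ler_norm.
have C0 : 0 < `|C| + 1 by rewrite ltr_wpDl.
apply: (le_trans (ler_wpM2r _ C1)); first by rewrite sumr_ge0.
apply: (le_trans (ler_wpM2l (ltW C0) (grid_dist _ _))).
rewrite mulrA ler_pdivrMr ?ltr0n// mulrC -ler_pdivrMl//.
near: n; exists (Num.bound (e^-1 * (d%:R * (`|C| + 1)))) => // n /= hn.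
apply: (le_trans (ltW (archi_boundP _))).
  by rewrite !mulr_ge0 ?invr_ge0// ltW.
by rewrite ler_nat (leq_trans hn).
Unshelve. all: by end_near. Qed.

End caratheodory.

Lemma measurable_ceil_eq d1 (X : measurableType d1) (R : realType)
    (f : X -> R) (z : int) : measurable_fun setT f ->
  measurable ((fun x => Num.ceil (f x)) @^-1` [set z]).
Proof.
move=> mf.
have -> : (fun x => Num.ceil (f x)) @^-1` [set z] =
    setT `&` f @^-1` [set` `](z - 1)%:~R, z%:~R]%R].
  rewrite setTI; apply/seteqP; split => x /=.
    by move=> /eqP; rewrite ceil_eq in_itv.
  by rewrite in_itv/= -ceil_eq => /eqP.
exact: mf.
Qed.

Section partial_measurable.
Context d1 (T : measurableType d1) (R : realType) (d : nat).

Lemma measurable_partial (f : T -> 'rV[R]_d -> R) (i : 'I_d) (x : 'rV[R]_d) :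
  (forall y, measurable_fun setT (f ^~ y)) ->
  (forall t, has_partial i (f t) x) ->
  measurable_fun setT (fun t => partial i (f t) x).
Proof.
move=> mf fx.
pose h (n : nat) : R := harmonic n.
apply: (@measurable_fun_cvg _ _ _ _
  (fun n t => (h n)^-1 * (f t (h n *: delta_mx 0 i + x) - f t x))).
  by move=> n; apply: measurable_funM => //; apply: measurable_funB.
move=> t _; have := fx t; rewrite /has_partial /derivable /partial /derive.
move=> cv.
have /cvgr_dnbhsP := cv.
move=> /(_ h)/(_ _)/=; apply; split => [n|]; first by rewrite /h/harmonic/= invr_eq0 pnatr_eq0.
exact: cvg_harmonic.
Qed.

End partial_measurable.

(** * Integration against mixtures and change of the policy parameter *)

Section mixture_integral.
Context d1 d2 (X : measurableType d1) (Y : measurableType d2) (R : realType).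
Variables (mu : {measure set X -> \bar R}) (m : X -> {measure set Y -> \bar R}).

Hypothesis mm : forall U, measurable U -> measurable_fun setT (m ^~ U).

Import HBNNSimple.

Let integral_mixture_nnsfun (nu : {measure set Y -> \bar R}) (h : {nnsfun Y >-> R}) :
  (forall U, measurable U -> nu U = \int[mu]_x m x U)%E ->
  (\int[nu]_y (h y)%:E = \int[mu]_x \int[m x]_y (h y)%:E)%E.
Proof.
move=> nuE; rewrite integralT_nnsfun sintegralE.
under [RHS]eq_integral do rewrite integralT_nnsfun sintegralE.
rewrite ge0_integral_fsum//; last 2 first.
- by move=> r; apply: measurable_funeM; exact: mm.
- by move=> r x _; exact: nnsfun_mulemu_ge0.
apply: eq_fsbigr => r _; rewrite nuE//.
have [r0|r0] := leP 0 r; first by rewrite ge0_integralZl// ; exact: mm.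
have h0 : h @^-1` [set r] = set0 by exact: preimage_nnfun0.
by rewrite h0; rewrite !integral0_eq ?mule0// => x _; rewrite measure0 ?mule0.
Qed.

(** A density is the case [m_x = g(x) delta_x], a composition of kernels the case
    where [m] is a kernel. *)
Lemma ge0_integral_mixture (nu : {measure set Y -> \bar R}) (f : Y -> \bar R) :
  (forall U, measurable U -> nu U = \int[mu]_x m x U)%E ->
  (forall y, 0 <= f y)%E -> measurable_fun setT f ->
  (\int[nu]_y f y = \int[mu]_x \int[m x]_y f y)%E.
Proof.
move=> nuE f0 mf.
pose f_ := nnsfun_approx measurableT mf.
have approx (la : {measure set Y -> \bar R}) :
    (\int[la]_y f y = limn (fun n => \int[la]_y (f_ n y)%:E))%E.
  rewrite -monotone_convergence//.
  - apply: eq_integral => y _; apply/esym/cvg_lim => //.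
    exact: cvg_nnsfun_approx.
  - by move=> n; exact/measurable_EFinP.
  - by move=> n y _; rewrite lee_fin.
  - by move=> y _ a b ab; rewrite lee_fin; exact/lefP/nd_nnsfun_approx.
rewrite approx; under eq_fun do rewrite (integral_mixture_nnsfun _ nuE).
under [RHS]eq_integral do rewrite approx.
rewrite monotone_convergence//.
- move=> n; apply: measurable_fun_integral_kernel => //.
  + by move=> y; rewrite lee_fin.
  + exact/measurable_EFinP.
- by move=> n x _; apply: integral_ge0 => y _; rewrite lee_fin.
- move=> x _ a b ab; apply: ge0_le_integral => //.
  + by move=> y _; rewrite lee_fin.
  + exact/measurable_EFinP.
  + exact/measurable_EFinP.
  + by move=> y _; rewrite lee_fin; exact/lefP/nd_nnsfun_approx.
Qed.

End mixture_integral.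

Section density_integral.
Context d1 (Y : measurableType d1) (R : realType).
Variables (mu nu : {measure set Y -> \bar R}) (g : Y -> R).
Hypothesis g0 : forall y, 0 <= g y.
Hypothesis mg : measurable_fun setT g.
Hypothesis nuE : forall U, measurable U -> (nu U = \int[mu]_(y in U) (g y)%:E)%E.

Lemma ge0_integral_density (f : Y -> \bar R) :
  (forall y, 0 <= f y)%E -> measurable_fun setT f ->
  (\int[nu]_y f y = \int[mu]_y ((g y)%:E * f y))%E.
Proof.
move=> f0 mf.
pose m (y : Y) : {measure set Y -> \bar R} := mscale (NngNum (g0 y)) (\d_ y).
have mE y U : m y U = ((g y)%:E * (\1_U y)%:E)%E by [].
rewrite (@ge0_integral_mixture _ _ _ _ _ mu m).
- apply: eq_integral => y _; rewrite ge0_integral_mscale//.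
  by rewrite integral_dirac// diracT mul1e.
- move=> U mU; under eq_fun do rewrite mE.
  apply: emeasurable_funM; first exact/measurable_EFinP.
  exact/measurable_EFinP/measurable_indic.
- move=> U mU; rewrite nuE// integral_mkcond; apply: eq_integral => y _.
  by rewrite mE epatch_indic.
- by [].
- by [].
Qed.

End density_integral.

Section trajectory_density.
Context d1 d2 (S : measurableType d1) (A : measurableType d2) (R : realType).
Variables (M : mdp S A R) (d : nat) (pi : policy S A R d).
Implicit Types theta : 'rV[R]_d.

Lemma measurable_tcons n (x : S * A) :
  measurable_fun setT (fun y : n.-tuple (S * A) => [tuple of x :: y]).
Proof. by apply: measurable_cons. Qed.

Lemma ge0_integral_kmix d3 d4 (X : measurableType d3) (Y : measurableType d4)
    (P : probability X R) (k : R.-pker X ~> Y) (f : Y -> \bar R) :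
  (forall y, 0 <= f y)%E -> measurable_fun setT f ->
  (\int[kmix P k]_y f y = \int[P]_x \int[k x]_y f y)%E.
Proof.
move=> f0 mf; apply: ge0_integral_mixture => // U mU.
exact: measurable_kernel.
Qed.

(** The recursion on the length of a trajectory sees everything that follows the
    first action as one kernel [k], which depends on [theta] only through the
    remaining steps. *)
Lemma traj_kerS_split theta n : exists k : R.-pker (S * A) ~> n.+1.-tuple (S * A),
  (forall x f, (forall y, 0 <= f y)%E -> measurable_fun setT f ->
   (\int[k x]_z f z =
    \int[transition M x]_s \int[traj_ker M pi theta n s]_y f [tuple of x :: y])%E) /\
  (forall s f, (forall y, 0 <= f y)%E -> measurable_fun setT f ->
   (\int[traj_ker M pi theta n.+1 s]_z f z =
    \int[policy_ker pi theta s]_a \int[k (s, a)]_z f z)%E).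
Proof.
exists (mkcomp (transition M) (mkcomp (kweaken (traj_ker M pi theta n))
  (kdirac (@measurable_traj_cons _ _ S A n)))); split => [x|s] f f0 mf; last first.
  by rewrite [LHS]integral_kcomp.
rewrite [LHS]integral_kcomp//; apply: eq_integral => s _.
rewrite [LHS]integral_kcomp//; apply: eq_integral => y _.
by rewrite [LHS]integral_dirac// diracT mul1e.
Qed.

Definition pdf_ratio theta1 theta2 (x : S * A) : R :=
  policy_pdf pi theta2 x / policy_pdf pi theta1 x.

Lemma pdf_ratio_ge0 theta1 theta2 x : 0 <= pdf_ratio theta1 theta2 x.
Proof. by rewrite divr_ge0// ltW// policy_pdf_gt0. Qed.

Lemma measurable_fun_inv_pos d3 (X : measurableType d3) (f : X -> R) :
  (forall x, 0 < f x) -> measurable_fun setT f ->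
  measurable_fun setT (fun x => (f x)^-1).
Proof.
move=> f0 mf.
rewrite (_ : (fun x => _) = expR \o (fun x => - ln (f x))).
  by apply: measurableT_comp => //; apply: measurableT_comp => //; apply: measurableT_comp.
by apply/funext => x /=; rewrite expRN lnK// posrE.
Qed.

Lemma measurable_pdf_ratio theta1 theta2 :
  measurable_fun setT (pdf_ratio theta1 theta2).
Proof.
apply: measurable_funM; first exact: measurable_policy_pdf.
by apply: measurable_fun_inv_pos => [x|]; [exact: policy_pdf_gt0|exact: measurable_policy_pdf].
Qed.

Lemma ge0_integral_policy_ker theta1 theta2 s (f : A -> \bar R) :
  (forall a, 0 <= f a)%E -> measurable_fun setT f ->
  (\int[policy_ker pi theta2 s]_a f a =
   \int[policy_ker pi theta1 s]_a ((pdf_ratio theta1 theta2 (s, a))%:E * f a))%E.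
Proof.
move=> f0 mf.
have mpdf theta : measurable_fun setT (fun a => policy_pdf pi theta (s, a)).
  by apply: (measurableT_comp (measurable_policy_pdf pi theta)).
have pdf0 theta a : 0 <= policy_pdf pi theta (s, a) by exact/ltW/policy_pdf_gt0.
have mr : measurable_fun setT (fun a => pdf_ratio theta1 theta2 (s, a)).
  by apply: (measurableT_comp (measurable_pdf_ratio theta1 theta2)).
rewrite (ge0_integral_density (pdf0 theta2) (mpdf theta2) (policy_kerE pi theta2 s))//.
rewrite (ge0_integral_density (pdf0 theta1) (mpdf theta1) (policy_kerE pi theta1 s))//.
- apply: eq_integral => a _; rewrite muleA -EFinM; congr (_%:E * _)%E.
  by rewrite /pdf_ratio mulrC divfK// gt_eqF// policy_pdf_gt0.
- by move=> a; rewrite mule_ge0// lee_fin pdf_ratio_ge0.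
- by apply: emeasurable_funM => //; exact/measurable_EFinP.
Qed.

(** By induction on the length: only the action densities change with the
    parameter, and each contributes its ratio. *)
Lemma ge0_integral_traj_ker theta1 theta2 n s (f : n.-tuple (S * A) -> \bar R) :
  (forall y, 0 <= f y)%E -> measurable_fun setT f ->
  (\int[traj_ker M pi theta2 n s]_y f y =
   \int[traj_ker M pi theta1 n s]_y
     ((\prod_(t < n) pdf_ratio theta1 theta2 (tnth y t))%:E * f y))%E.
Proof.
elim: n s f => [|n ih] s f f0 mf.
  by apply: eq_integral => y _; rewrite big_ord0 mul1e.
have mprod k : measurable_fun setT (fun y : k.-tuple (S * A) =>
    \prod_(t < k) pdf_ratio theta1 theta2 (tnth y t)).
  apply: measurable_prod => t _; apply: measurableT_comp; first exact: measurable_pdf_ratio.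
  exact: measurable_tnth.
have prod0 k (y : k.-tuple (S * A)) : 0 <= \prod_(t < k) pdf_ratio theta1 theta2 (tnth y t).
  by apply: prodr_ge0 => t _; exact: pdf_ratio_ge0.
have mcons x : measurable_fun setT (fun y : n.-tuple (S * A) => f [tuple of x :: y]).
  by apply: measurableT_comp => //; exact: measurable_tcons.
set F := (fun z : n.+1.-tuple _ => _ * _)%E.
have mF : measurable_fun setT F.
  by apply: emeasurable_funM => //; apply/measurable_EFinP; exact: mprod.
have F0 z : (0 <= F z)%E by rewrite /F mule_ge0// lee_fin.
have [k2 [k2E ->]] := traj_kerS_split theta2 n => //.
have [k1 [k1E ->]] := traj_kerS_split theta1 n => //.
rewrite (ge0_integral_policy_ker theta1); last 2 first.
- by move=> a; apply: integral_ge0.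
- apply: (measurable_fun_integral_kernel (l := fun a => k2 (s, a))) => // U mU.
  by apply: (measurableT_comp (measurable_kernel k2 _ mU)).
apply: eq_integral => a _; rewrite k2E// k1E//.
have mint x : measurable_fun setT (fun s' => \int[traj_ker M pi theta1 n s']_y
    ((\prod_(t < n) pdf_ratio theta1 theta2 (tnth y t))%:E * f [tuple of x :: y]))%E.
  apply: measurable_fun_integral_kernel => [U mU|y|].
  - exact: measurable_kernel.
  - by rewrite mule_ge0// lee_fin.
  - by apply: emeasurable_funM => //; apply/measurable_EFinP; exact: mprod.
under eq_integral => s' _ do rewrite ih//.
rewrite -ge0_integralZl//; last 2 first.
- by move=> s' _; apply: integral_ge0 => y _; rewrite mule_ge0// lee_fin.
- by rewrite lee_fin pdf_ratio_ge0.
apply: eq_integral => s' _.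
rewrite -ge0_integralZl//; last 3 first.
- by apply: emeasurable_funM => //; apply/measurable_EFinP; exact: mprod.
- by move=> y _; rewrite mule_ge0// lee_fin.
- by rewrite lee_fin pdf_ratio_ge0.
apply: eq_integral => y _; rewrite /F muleA -EFinM big_ord_recl.
by congr (_%:E * _)%E; congr (_ * _); apply: eq_bigr => t _; rewrite tnthS.
Qed.

Lemma importance_weightE (tau : traj M) theta1 theta2 :
  importance_weight pi tau theta1 theta2 =
  \prod_(t < horizon M) pdf_ratio theta1 theta2 (tnth tau t).
Proof. by rewrite /importance_weight /likelihood -prodf_div. Qed.

Lemma importance_weight_ge0 (tau : traj M) theta1 theta2 :
  0 <= importance_weight pi tau theta1 theta2.
Proof. by rewrite importance_weightE prodr_ge0// => t _; exact: pdf_ratio_ge0. Qed.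

Lemma measurable_importance_weight theta1 theta2 :
  measurable_fun setT (fun tau : traj M => importance_weight pi tau theta1 theta2).
Proof.
under eq_fun do rewrite importance_weightE.
apply: measurable_prod => t _; apply: measurableT_comp; first exact: measurable_pdf_ratio.
exact: measurable_tnth.
Qed.

(** Importance sampling: the initial and transition kernels do not depend on
    the parameter, so only the ratios of the action densities survive. *)
Lemma ge0_integral_traj_law theta1 theta2 (f : traj M -> \bar R) :
  (forall y, 0 <= f y)%E -> measurable_fun setT f ->
  (\int[traj_law M pi theta2]_y f y =
   \int[traj_law M pi theta1]_y
     ((importance_weight pi y theta1 theta2)%:E * f y))%E.
Proof.
move=> f0 mf; set g := (fun y => _ * _)%E.
have g0 y : (0 <= g y)%E by rewrite mule_ge0// lee_fin importance_weight_ge0.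
have mg : measurable_fun setT g.
  by apply: emeasurable_funM => //; apply/measurable_EFinP; exact: measurable_importance_weight.
transitivity (\int[init M]_s \int[traj_ker M pi theta2 (horizon M) s]_y f y)%E.
  exact: ge0_integral_kmix.
transitivity (\int[init M]_s \int[traj_ker M pi theta1 (horizon M) s]_y g y)%E;
  last by apply/esym; exact: ge0_integral_kmix.
apply: eq_integral => s _.
rewrite (@ge0_integral_traj_ker theta1 theta2 (horizon M) s f f0 mf).
by apply: eq_integral => y _; rewrite /g importance_weightE.
Qed.

End trajectory_density.

(** * Averages of conditionally independent samples *)

Section freezing.
Context d0 d1 d2 (Omega : measurableType d0) (X : measurableType d1)
  (Y : measurableType d2) (R : realType).

(** It suffices to compare finite measures on rectangles whose second side runs
    through a generating pi-system, which lets products nest. *)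
Lemma finite_measure_rect_unique (G : set (set Y))
    (m1 m2 : {measure set (X * Y) -> \bar R}) :
  measurable = <<s G >> -> setI_closed G -> G setT ->
  (m1 setT < +oo)%E ->
  (forall A B, measurable A -> G B -> m1 (A `*` B) = m2 (A `*` B)) ->
  forall V, measurable V -> m1 V = m2 V.
Proof.
move=> mG GI GT m1oo m12 V mV.
pose C : set (set (X * Y)) := [set C | exists A B, [/\ measurable A, G B & C = A `*` B]].
have GM B : G B -> measurable B by move=> GB; rewrite mG; exact: sub_sigma_algebra.
apply: (@measure_unique _ _ _ C (fun=> setT)) => //.
- rewrite measurable_prod_measurableType; apply/seteqP; split; last first.
    apply: smallest_sub; first exact: smallest_sigma_algebra.
    move=> _ [A [B [mA GB ->]]]; apply: sub_sigma_algebra.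
    by exists A => //; exists B => //; exact: GM.
  apply: smallest_sub; first exact: smallest_sigma_algebra.
  move=> _ [A mA [B mB <-]].
  have [s0 sD sU] : sigma_algebra setT <<s C >> by exact: smallest_sigma_algebra.
  have mAT : <<s C >> (A `*` [set: Y]).
    by apply: sub_sigma_algebra; exists A, setT.
  pose K : set (set Y) := [set B | <<s C >> (A `*` B)].
  suff GK : <<s G >> `<=` K by apply: (GK B); rewrite -mG.
  apply: smallest_sub; last by move=> B' GB'; apply: sub_sigma_algebra; exists A, B'.
  split => [|B' KB'|F KF].
  + by rewrite /K/= setX0.
  + rewrite setTD /K/=.
    have -> : (A `*` ~` B') = ~` ((A `*` B') `|` ~` (A `*` setT)).
      apply/seteqP; split => [[x y] [/= Ax By]|[x y] /= H].
        by move=> [[]|] //; apply.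
      have Ax : A x by apply: contrapT => nAx; apply: H; right => -[].
      by split => // B'y; apply: H; left.
    have clC U : <<s C >> U -> <<s C >> (~` U) by move=> ?; rewrite -setTD; exact: sD.
    apply: (clC); rewrite -bigcup2E; apply: sU => i; rewrite /bigcup2.
    by case: ifPn => // _; case: ifPn => // _; exact: clC.
  + rewrite /K/= (_ : A `*` _ = \bigcup_i (A `*` F i)); first exact: sU.
    apply/seteqP; split => [[x y] [/= Ax [i _ Fy]]|[x y] [i _ [/= Ax Fy]]].
      by exists i.
    by split => //; exists i.
- move=> _ _ [A [B [mA mB ->]]] [A' [B' [mA' mB' ->]]]; rewrite -setXI.
  by exists (A `&` A'), (B `&` B'); split => //; [exact: measurableI|exact: GI].
- by move=> _; exists setT, setT; split => //; rewrite setXTT.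
- by rewrite bigcup_const.
- by move=> _ [A [B [mA mB ->]]]; exact: m12.
Qed.

Section pullback.
Variables (Z : Omega -> X) (mZ : measurable_fun setT Z) (k : R.-pker X ~> Y).

Definition kpull of measurable_fun setT Z : Omega -> {measure set Y -> \bar R} :=
  fun w => k (Z w).

Let measurable_kpull U : measurable U -> measurable_fun setT (kpull mZ ^~ U).
Proof. by move=> mU; apply: (measurableT_comp (measurable_kernel k U mU)). Qed.

HB.instance Definition _ := isKernel.Build _ _ _ Y R (kpull mZ) measurable_kpull.

Let kpull_prob w : kpull mZ w setT = 1%E.
Proof. by rewrite /kpull prob_kernel. Qed.

HB.instance Definition _ :=
  Kernel_isProbability.Build _ _ _ Y R (kpull mZ) kpull_prob.

End pullback.

Variables (P : probability Omega R) (Z : Omega -> X) (W : Omega -> Y)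
  (k : R.-pker X ~> Y) (E : set X) (G : set (set Y)).
Hypotheses (mG : measurable = <<s G >>) (GI : setI_closed G) (GT : G setT).
Hypotheses (mZ : measurable_fun setT Z) (mW : measurable_fun setT W)
  (mE : measurable E).
Hypothesis law_W : forall A U, measurable A -> G U -> A `<=` E ->
  (P (Z @^-1` A `&` W @^-1` U) = \int[P]_(w in Z @^-1` A) k (Z w) U)%E.

(** [k] is the conditional law of [W] given [Z] on the event [Z \in E];
    the statement is that [Z] can be frozen when integrating over [W]. *)
Lemma ge0_integral_freeze (h : X * Y -> \bar R) :
  (forall z, 0 <= h z)%E -> measurable_fun setT h ->
  (\int[P]_(w in Z @^-1` E) h (Z w, W w) =
   \int[P]_(w in Z @^-1` E) \int[k (Z w)]_y h (Z w, y))%E.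
Proof.
move=> h0 mh.
have mZW : measurable_fun setT (fun w => (Z w, W w)) by exact: measurable_fun_pair.
have mZy : measurable_fun setT (fun wy : Omega * Y => (Z wy.1, wy.2)).
  by apply: measurable_fun_pair => //; apply: measurableT_comp.
pose k1 : R.-pker Omega ~> (X * Y)%type := kdirac mZW.
pose k2 : R.-pker Omega ~> (X * Y)%type := mkcomp (kpull k mZ) (kdirac mZy).
have k2E w f : (forall z, 0 <= f z)%E -> measurable_fun setT f ->
    (\int[k2 w]_z f z = \int[k (Z w)]_y f (Z w, y))%E.
  move=> f0 mf; rewrite [LHS]integral_kcomp//; apply: eq_integral => y _.
  by rewrite [LHS]integral_dirac// diracT mul1e.
have mD : measurable (E `*` [set: Y]) by exact: measurableX.
have mZE A : measurable A -> measurable (Z @^-1` A).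
  by move=> mA; rewrite -[_ @^-1` _]setTI; exact: mZ.
pose hE := h \_ (E `*` [set: Y]).
have hE0 z : (0 <= hE z)%E by rewrite /hE erestrict_ge0.
have mhE : measurable_fun setT hE by apply/(measurable_restrictT _ mD); exact: measurable_funTS.
have hEE w y : hE (Z w, y) = (h (Z w, y) * (\1_(Z @^-1` E) w)%:E)%E.
  rewrite /hE /patch indicE.
  have -> : ((Z w, y) \in E `*` [set: Y]) = (w \in Z @^-1` E).
    by apply/idP/idP; rewrite !inE => // -[].
  by case: ifPn => _; rewrite ?mule1 ?mule0.
transitivity (\int[kmix P k1]_(z in E `*` setT) h z)%E.
  rewrite [RHS]integral_mkcond (ge0_integral_kmix _ _ hE0 mhE).
  rewrite integral_mkcond; apply: eq_integral => w _.
  by rewrite [RHS]integral_dirac// diracT mul1e hEE epatch_indic.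

transitivity (\int[kmix P k2]_(z in E `*` setT) h z)%E; last first.
  rewrite [LHS]integral_mkcond (ge0_integral_kmix _ _ hE0 mhE).
  rewrite [RHS]integral_mkcond; apply: eq_integral => w _.
  rewrite k2E//; under eq_integral do rewrite hEE muleC.
  rewrite ge0_integralZl//; last by apply: measurableT_comp.
  by rewrite muleC epatch_indic.
apply: eq_measure_integral => V mV VE.
transitivity (mrestr (kmix P k1) mD V).
  by rewrite /mrestr; congr (kmix _ _ _); exact/esym/setIidPl.
transitivity (mrestr (kmix P k2) mD V); last first.
  by rewrite /mrestr; congr (kmix _ _ _); exact/setIidPl.
apply: (finite_measure_rect_unique mG) => //.
  apply: (@le_lt_trans _ _ 1%E); last exact: ltry.
  by apply: probability_le1; exact: measurableI.
move=> A U mA GU.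
have mU : measurable U by rewrite mG; exact: sub_sigma_algebra.
have AUE : A `*` U `&` E `*` [set: Y] = (A `&` E) `*` U by rewrite -setXI setIT.
change (kmix P k1 (A `*` U `&` E `*` [set: Y]) = kmix P k2 (A `*` U `&` E `*` [set: Y])).
rewrite {}AUE.
have mAE : measurable (A `&` E) by exact: measurableI.
transitivity (P (Z @^-1` (A `&` E) `&` W @^-1` U)).
  transitivity (\int[P]_w (\1_(Z @^-1` (A `&` E) `&` W @^-1` U) w)%:E)%E.
    by apply: eq_integral => w _; rewrite /= diracE !indicE in_setX in_setI.
  rewrite integral_indic ?setIT//.
  by apply: measurableI; [exact: mZE|rewrite -[_ @^-1` _]setTI; exact: mW].
rewrite law_W//.
rewrite integral_mkcond /kmix; apply: eq_integral => w _.
have mAU : measurable ((A `&` E) `*` U) by exact: measurableX.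
transitivity (\int[k2 w]_z (\1_((A `&` E) `*` U) z)%:E)%E; last first.
  by rewrite integral_indic// setIT.
rewrite k2E//; last exact/measurable_EFinP/measurable_indic.
transitivity (\int[k (Z w)]_y ((\1_(Z @^-1` (A `&` E)) w)%:E * (\1_U y)%:E))%E.
  rewrite ge0_integralZl//; last exact/measurable_EFinP/measurable_indic.
  by rewrite integral_indic// setIT muleC epatch_indic.
apply: eq_integral => y _; rewrite -EFinM !indicE -natrM mulnb.
by rewrite in_setX.
Qed.

End freezing.

Section orthogonality.
Context d0 (Omega : measurableType d0) (R : realType)
  (mu : {measure set Omega -> \bar R}) (D : set Omega).
Hypothesis mD : measurable D.

Lemma ge0_integrable (f : Omega -> R) : measurable_fun D f -> (forall w, 0 <= f w) ->
  (\int[mu]_(w in D) (f w)%:E < +oo)%E -> mu.-integrable D (EFin \o f).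
Proof.
move=> mf f0 foo; apply/integrableP; split; first exact/measurable_EFinP.
by under eq_integral do rewrite /= ger0_norm//.
Qed.

Lemma integrable_mul_sqr (f g : Omega -> R) :
  measurable_fun D f -> measurable_fun D g ->
  (\int[mu]_(w in D) (f w ^+ 2)%:E < +oo)%E ->
  (\int[mu]_(w in D) (g w ^+ 2)%:E < +oo)%E ->
  mu.-integrable D (fun w => (f w * g w)%:E).
Proof.
move=> mf mg foo goo.
apply: (@le_integrable _ _ _ _ _ mD _ (fun w => (f w ^+ 2)%:E + (g w ^+ 2)%:E)%E).
- by apply/measurable_EFinP; apply: measurable_funM.
- move=> w _; rewrite /= lee_fin [leRHS]ger0_norm ?addr_ge0 ?sqr_ge0//.
  rewrite normrM -(@real_normK _ (f w)) ?num_real// -(@real_normK _ (g w)) ?num_real//.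
  have := normr_ge0 (f w); have := normr_ge0 (g w).
  move: `|f w| `|g w| => a b a0 b0.
  have := sqr_ge0 (a - b); nra.
- by apply: integrableD => //; apply: ge0_integrable => // [|w];
    [exact: measurable_funX|exact: sqr_ge0|exact: measurable_funX|exact: sqr_ge0].
Qed.

Lemma integral_sqr_sum_orthogonal n (y : 'I_n -> Omega -> R) :
  (forall p, measurable_fun D (y p)) ->
  (forall p, \int[mu]_(w in D) (y p w ^+ 2)%:E < +oo)%E ->
  (forall p q, p != q -> \int[mu]_(w in D) (y p w * y q w)%:E = 0)%E ->
  (\int[mu]_(w in D) ((\sum_(p < n) y p w) ^+ 2)%:E =
   \sum_(p < n) \int[mu]_(w in D) (y p w ^+ 2)%:E)%E.
Proof.
move=> my yoo yy.
transitivity (\int[mu]_(w in D) \sum_(p < n) \sum_(q < n) (y p w * y q w)%:E)%E.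
  apply: eq_integral => w _; rewrite expr2 mulr_suml -sumEFin; apply: eq_bigr => p _.
  by rewrite mulr_sumr -sumEFin.
have iy p q : mu.-integrable D (fun w => (y p w * y q w)%:E) by exact: integrable_mul_sqr.
rewrite integral_sum//; last by move=> p; apply: integrable_sum.
apply: eq_bigr => p _; rewrite integral_sum// (bigD1 p)//= big1 ?adde0.
  by apply: eq_integral => w _; rewrite -expr2.
by move=> q qp; rewrite yy// eq_sym.
Qed.

End orthogonality.

Section centered_samples.
Context d0 d1 d2 (Omega : measurableType d0) (X : measurableType d1)
  (Y : measurableType d2) (R : realType).
Variables (P : probability Omega R) (Z : Omega -> X) (E : set X).
Hypotheses (mZ : measurable_fun setT Z) (mE : measurable E).
Local Notation D := (Z @^-1` E).

Let mD : measurable D.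
Proof. by rewrite -[_ @^-1` _]setTI; exact: mZ. Qed.

(** The positive and negative parts of a centered integrand are compared
    separately, so that only integrals of nonnegative functions are frozen. *)
Lemma integral_freeze_centered (W : Omega -> Y)
    (k : R.-pker X ~> Y) (G : set (set Y)) (f1 f2 : X * Y -> R) :
  measurable = <<s G >> -> setI_closed G -> G setT ->
  measurable_fun setT W ->
  (forall A U, measurable A -> G U -> A `<=` E ->
    (P (Z @^-1` A `&` W @^-1` U) = \int[P]_(w in Z @^-1` A) k (Z w) U)%E) ->
  measurable_fun setT f1 -> measurable_fun setT f2 ->
  (forall z, 0 <= f1 z) -> (forall z, 0 <= f2 z) ->
  (forall x, \int[k x]_y (f1 (x, y))%:E = \int[k x]_y (f2 (x, y))%:E)%E ->
  P.-integrable D (fun w => (f1 (Z w, W w) + f2 (Z w, W w))%:E) ->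
  (\int[P]_(w in D) (f1 (Z w, W w) - f2 (Z w, W w))%:E = 0)%E.
Proof.
move=> mG GI GT mW law mf1 mf2 f10 f20 f12 ifD.
have mZW : measurable_fun setT (fun w => (Z w, W w)) by exact: measurable_fun_pair.
have i1 : P.-integrable D (EFin \o (fun w => f1 (Z w, W w))).
  apply: le_integrable ifD => //.
    by apply/measurable_EFinP; apply: measurable_funTS; apply: measurableT_comp.
  by move=> w _; rewrite /= lee_fin !ger0_norm ?addr_ge0// lerDl.
have i2 : P.-integrable D (EFin \o (fun w => f2 (Z w, W w))).
  apply: le_integrable ifD => //.
    by apply/measurable_EFinP; apply: measurable_funTS; apply: measurableT_comp.
  by move=> w _; rewrite /= lee_fin !ger0_norm ?addr_ge0// lerDr.
under eq_integral do rewrite EFinB.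
rewrite integralB_EFin//.
have frz (f : X * Y -> R) : measurable_fun setT f -> (forall z, 0 <= f z) ->
    (\int[P]_(w in D) (f (Z w, W w))%:E = \int[P]_(w in D) \int[k (Z w)]_y (f (Z w, y))%:E)%E.
  move=> mf f0; apply: (ge0_integral_freeze mG GI GT mZ mW mE law (h := fun z => (f z)%:E)).
    by move=> z; rewrite lee_fin.
  exact/measurable_EFinP.
rewrite !frz//.
under eq_integral do rewrite f12.
rewrite subee// -frz//.
have := integrable_fin_num mD i2.
by [].
Qed.

End centered_samples.

Section pair_kernel.
Context d1 d2 (X : measurableType d1) (T : measurableType d2) (R : realType).
Variable k : R.-pker X ~> T.

Let measurable_pair_of : measurable_fun setT (fun p : (X * T) * T => (p.1.2, p.2)).
Proof.
apply: measurable_fun_pair => //.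
by apply: (measurableT_comp measurable_snd measurable_fst).
Qed.

(** Two independent draws from [k x]. *)
Definition pair_ker : R.-pker X ~> (T * T)%type :=
  mkcomp k (mkcomp (kpull k (@measurable_fst _ _ X T)) (kdirac measurable_pair_of)).

Lemma ge0_integral_pair_ker x (h : T * T -> \bar R) :
  (forall z, 0 <= h z)%E -> measurable_fun setT h ->
  (\int[pair_ker x]_z h z = \int[k x]_s \int[k x]_t h (s, t))%E.
Proof.
move=> h0 mh; rewrite [LHS]integral_kcomp//; apply: eq_integral => s _.
rewrite [LHS]integral_kcomp//; apply: eq_integral => t _.
by rewrite [LHS]integral_dirac// diracT mul1e.
Qed.

Lemma pair_kerM x (a b : T -> \bar R) :
  (forall t, 0 <= a t)%E -> measurable_fun setT a ->
  (forall t, 0 <= b t)%E -> measurable_fun setT b ->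
  (\int[pair_ker x]_z (a z.1 * b z.2) =
   (\int[k x]_s a s) * \int[k x]_t b t)%E.
Proof.
move=> a0 ma b0 mb.
rewrite ge0_integral_pair_ker; last 2 first.
- by move=> z; rewrite mule_ge0.
- by apply: emeasurable_funM; apply: measurableT_comp.
under eq_integral => s _ do rewrite /= ge0_integralZl//.
rewrite -ge0_integralZr//.
by apply: integral_ge0.
Qed.

Lemma pair_ker_rect x U V : measurable U -> measurable V ->
  pair_ker x (U `*` V) = (k x U * k x V)%E.
Proof.
move=> mU mV.
have ind (S : set T) : measurable S -> (\int[k x]_t (\1_S t)%:E = k x S)%E.
  by move=> mS; rewrite integral_indic// setIT.
rewrite -(ind U)// -(ind V)// -pair_kerM//.
- rewrite -[LHS](_ : (\int[pair_ker x]_z (\1_(U `*` V) z)%:E)%E = _).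
    apply: eq_integral => -[s t] _; rewrite -EFinM !indicE -natrM mulnb.
    by rewrite in_setX.
  by rewrite integral_indic ?setIT//; exact: measurableX.
- by apply/measurable_EFinP; exact: measurable_indic.
- by apply/measurable_EFinP; exact: measurable_indic.
Qed.

End pair_kernel.

Section iid_samples.
Context d0 d1 d2 (Omega : measurableType d0) (X : measurableType d1)
  (T : measurableType d2) (R : realType).
Variables (P : probability Omega R) (Z : Omega -> X) (E : set X).
Variables (k : R.-pker X ~> T) (n : nat) (tau : 'I_n -> Omega -> T).
Hypotheses (mZ : measurable_fun setT Z) (mE : measurable E).
Hypothesis mtau : forall i, measurable_fun setT (tau i).
Hypothesis iid : forall A (U : 'I_n -> set T), measurable A -> A `<=` E ->
  (forall i, measurable (U i)) ->
  (P (Z @^-1` A `&` \bigcap_(i in [set: 'I_n]) tau i @^-1` U i) =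
   \int[P]_(w in Z @^-1` A) (\prod_(i < n) fine (k (Z w) (U i)))%:E)%E.
Local Notation D := (Z @^-1` E).

Let mD : measurable D.
Proof. by rewrite -[_ @^-1` _]setTI; exact: mZ. Qed.

Let fin_k x U : measurable U -> k x U \is a fin_num.
Proof. by move=> mU; exact: (finite_kernel_measure k x). Qed.

(** The samples other than [i] and [j] are put in the full set, whose probability
    is 1. *)
Lemma law_pair i j A U V : i != j -> measurable A -> A `<=` E ->
  measurable U -> measurable V ->
  (P (Z @^-1` A `&` (fun w => (tau i w, tau j w)) @^-1` (U `*` V)) =
   \int[P]_(w in Z @^-1` A) pair_ker k (Z w) (U `*` V))%E.
Proof.
move=> ij mA AE mU mV.
pose S l := if l == i then U else if l == j then V else setT.
have mS l : measurable (S l) by rewrite /S; case: ifP => // _; case: ifP.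
have -> : (fun w => (tau i w, tau j w)) @^-1` (U `*` V) =
    \bigcap_(l in [set: 'I_n]) tau l @^-1` S l.
  apply/seteqP; split => [w [/= Uw Vw] l _|w H].
    by rewrite /S /=; case: ifP => [/eqP ->//|_]; case: ifP => [/eqP ->|].
  have := H i Logic.I; have := H j Logic.I; rewrite /S /= !eqxx.
  by rewrite eq_sym (negbTE ij).
rewrite iid//; apply: eq_integral => w _; rewrite pair_ker_rect//.
rewrite (bigD1 i)//= (bigD1 j) 1?eq_sym//= big1 => [|l /andP[li lj]].
  by rewrite mulr1 {1}/S eqxx /S eq_sym (negbTE ij) eqxx EFinM !fineK// fin_k.
by rewrite /S (negbTE li) (negbTE lj) prob_kernel.
Qed.

Lemma law_single i A U : measurable A -> measurable U -> A `<=` E ->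
  (P (Z @^-1` A `&` tau i @^-1` U) = \int[P]_(w in Z @^-1` A) k (Z w) U)%E.
Proof.
move=> mA mU AE.
pose S l := if l == i then U else setT.
have mS l : measurable (S l) by rewrite /S; case: ifP.
have -> : tau i @^-1` U = \bigcap_(l in [set: 'I_n]) tau l @^-1` S l.
  apply/seteqP; split => [w /= Uw l _|w H].
    by rewrite /S /=; case: ifP => [/eqP ->|].
  by have := H i Logic.I; rewrite /S /= eqxx.
rewrite iid//; apply: eq_integral => w _.
rewrite (bigD1 i)//= big1 => [|l li]; last by rewrite /S (negbTE li) prob_kernel.
by rewrite mulr1 /S eqxx fineK// fin_k.
Qed.

Variables (phi : X * T -> R) (u : X -> R).
Hypotheses (mphi : measurable_fun setT phi) (mu : measurable_fun setT u).
Hypothesis phi0 : forall x, (\int[k x]_t (phi (x, t))%:E = 0)%E.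

Let pos {I} (f : I -> R) z := Num.max (f z) 0.
Let neg {I} (f : I -> R) z := Num.max (- f z) 0.

Let posneg I (f : I -> R) z : f z = pos f z - neg f z.
Proof.
rewrite /pos /neg; case: (leP (f z) 0) => h.
  by rewrite (max_idPl _) ?oppr_ge0// opprK add0r.
by rewrite (max_idPr _) ?subr0// oppr_le0 ltW.
Qed.

Let pos_ge0 I (f : I -> R) z : 0 <= pos f z. Proof. by rewrite le_max lexx orbT. Qed.

Let neg_ge0 I (f : I -> R) z : 0 <= neg f z. Proof. by rewrite le_max lexx orbT. Qed.

Let mul_posneg I J (f : I -> R) (g : J -> R) y z : f y * g z =
  (pos f y * pos g z + neg f y * neg g z) - (pos f y * neg g z + neg f y * pos g z).
Proof. by rewrite {1}(posneg f) {1}(posneg g); ring. Qed.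

Let norm_posneg I (f : I -> R) z : `|f z| = pos f z + neg f z.
Proof.
rewrite /pos /neg; case: (leP (f z) 0) => h.
  by rewrite (max_idPl _) ?oppr_ge0// add0r ler0_norm.
by rewrite (max_idPr _) ?oppr_le0 ?ltW// addr0 gtr0_norm.
Qed.

Let measurable_pos d (I : measurableType d) (f : I -> R) :
  measurable_fun setT f -> measurable_fun setT (pos f).
Proof. by move=> mf; apply: measurable_maxr. Qed.

Let measurable_neg d (I : measurableType d) (f : I -> R) :
  measurable_fun setT f -> measurable_fun setT (neg f).
Proof. by move=> mf; apply: measurable_maxr => //; exact: measurableT_comp. Qed.

Let mean_parts x : (\int[k x]_t (pos phi (x, t))%:E =
  \int[k x]_t (neg phi (x, t))%:E)%E.
Proof.
have := phi0 x; rewrite integralE.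
have -> : (\int[k x]_t ((fun t => (phi (x, t))%:E)^\+)%E t = \int[k x]_t (pos phi (x, t))%:E)%E.
  by apply: eq_integral => t _; rewrite funeposE EFin_max.
have -> : (\int[k x]_t ((fun t => (phi (x, t))%:E)^\-)%E t = \int[k x]_t (neg phi (x, t))%:E)%E.
  by apply: eq_integral => t _; rewrite funenegE EFin_max.
set a := (\int[_]__ _)%E; set b := (\int[_]__ _)%E.
have a0 : (0 <= a)%E by apply: integral_ge0 => t _; rewrite lee_fin le_max lexx orbT.
have b0 : (0 <= b)%E by apply: integral_ge0 => t _; rewrite lee_fin le_max lexx orbT.
move: a b a0 b0 => [a| |] [b| |]//= _ _.
by rewrite -EFinB => -[] /eqP; rewrite subr_eq0 => /eqP ->.
Qed.

(** Conditionally on [Z], the errors [phi (Z, tau i)] are centered and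
    independent, so that they are orthogonal to each other and to any function
    of [Z]: averaging divides their second moment by [n]. *)
Lemma conditional_variance_le : (0 < n)%N ->
  (\int[P]_(w in D) ((n%:R^-1 * (\sum_(i < n) phi (Z w, tau i w)) + u (Z w)) ^+ 2)%:E
   <= \int[P]_(w in D) (n%:R^-1%:E * \int[k (Z w)]_t (phi (Z w, t) ^+ 2)%:E
        + (u (Z w) ^+ 2)%:E))%E.
Proof.
move=> n0; set c : R := n%:R^-1.
have c0 : 0 < c by rewrite invr_gt0 ltr0n.
pose q i w := phi (Z w, tau i w).
have mq i : measurable_fun D (q i).
  by apply: measurable_funTS; apply: measurableT_comp => //; exact: measurable_fun_pair.
have muZ : measurable_fun D (u \o Z) by apply: measurable_funTS; exact: measurableT_comp.
pose V x := (\int[k x]_t (phi (x, t) ^+ 2)%:E)%E.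
have V0 x : (0 <= V x)%E by apply: integral_ge0 => t _; rewrite lee_fin sqr_ge0.
have mphi2 : measurable_fun setT (fun z => (phi z ^+ 2)%:E).
  by apply/measurable_EFinP; exact: measurable_funX.
have mV : measurable_fun D (V \o Z).
  apply: measurable_funTS; apply: measurableT_comp mZ.
  by apply: (measurable_fun_integral_finite_kernel (fun z => (phi z ^+ 2)%:E) k) => // z;
    rewrite lee_fin sqr_ge0.
have mu2 : measurable_fun D (fun w => (u (Z w) ^+ 2)%:E).
  by apply/measurable_EFinP; exact: measurable_funX.
pose SV := (\int[P]_(w in D) V (Z w))%E.
pose SU := (\int[P]_(w in D) (u (Z w) ^+ 2)%:E)%E.
have SV0 : (0 <= SV)%E by apply: integral_ge0.
have SU0 : (0 <= SU)%E by apply: integral_ge0 => w _; rewrite lee_fin sqr_ge0.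
have mT : measurable = <<s @measurable _ T >>.
  by apply/esym/sigma_algebra_id; exact: sigma_algebra_measurable.
have qV i : (\int[P]_(w in D) (q i w ^+ 2)%:E)%E = SV.
  apply: (ge0_integral_freeze mT _ _ mZ (mtau i) mE (k := k) _
     (h := fun z => (phi z ^+ 2)%:E)) => //.
  - exact: measurableI.
  - by move=> A U *; exact: law_single.
  - by move=> z; rewrite lee_fin sqr_ge0.
rewrite ge0_integralD//=; last 3 first.
- by move=> w _; apply: mule_ge0; [rewrite lee_fin ltW|exact: V0].
- by apply: emeasurable_funM.
- by move=> w _; rewrite lee_fin sqr_ge0.
rewrite ge0_integralZl//=; last 2 first.
- by move=> w _; exact: V0.
- by rewrite lee_fin ltW.
rewrite -/SU; change (\int[P]_(w in D) \int[k (Z w)]_t (phi (Z w, t) ^+ 2)%:E)%E with SV.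
have [SVoo|] := ltP SV +oo%E; last first.
  by rewrite leye_eq => /eqP ->; rewrite gt0_muley ?lte_fin// addye ?leey// gt_eqF// (lt_le_trans _ SU0).
have [SUoo|] := ltP SU +oo%E; last first.
  rewrite leye_eq => /eqP ->; rewrite addey ?leey// gt_eqF// (@lt_le_trans _ _ 0%E)//.
  by rewrite mule_ge0// lee_fin ltW.
have qoo i : (\int[P]_(w in D) (q i w ^+ 2)%:E < +oo)%E by rewrite qV.
have cross_u i : (\int[P]_(w in D) (u (Z w) * q i w)%:E = 0)%E.
  pose f1 (z : X * T) := pos u z.1 * pos phi z + neg u z.1 * neg phi z.
  pose f2 (z : X * T) := pos u z.1 * neg phi z + neg u z.1 * pos phi z.
  have mu1 : measurable_fun setT (fun z : X * T => pos u z.1).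
    by apply: (measurableT_comp (measurable_pos mu)).
  have mu1' : measurable_fun setT (fun z : X * T => neg u z.1).
    by apply: (measurableT_comp (measurable_neg mu)).
  under eq_integral => w _.
    have -> : u (Z w) * q i w = f1 (Z w, tau i w) - f2 (Z w, tau i w) by exact: mul_posneg.
    over.
  apply: (integral_freeze_centered mZ mE (k := k) mT).
  - exact: measurableI.
  - exact: measurableT.
  - exact: mtau.
  - by move=> A U *; exact: law_single.
  - by apply: measurable_funD; apply: measurable_funM => //; [exact: measurable_pos|exact: measurable_neg].
  - by apply: measurable_funD; apply: measurable_funM => //; [exact: measurable_neg|exact: measurable_pos].
  - by move=> z; rewrite addr_ge0// mulr_ge0.
  - by move=> z; rewrite addr_ge0// mulr_ge0.
  - have mpos x : measurable_fun setT (fun t => (pos phi (x, t))%:E).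
      apply/measurable_EFinP; apply: (measurableT_comp (measurable_pos mphi)).
      exact: pair1_measurable.
    have mneg x : measurable_fun setT (fun t => (neg phi (x, t))%:E).
      apply/measurable_EFinP; apply: (measurableT_comp (measurable_neg mphi)).
      exact: pair1_measurable.
    have lin x (a b : R) (f g : T -> R) : 0 <= a -> 0 <= b ->
        (forall t, 0 <= f t) -> (forall t, 0 <= g t) ->
        measurable_fun setT (EFin \o f) -> measurable_fun setT (EFin \o g) ->
        (\int[k x]_t (a * f t + b * g t)%:E =
         a%:E * \int[k x]_t (f t)%:E + b%:E * \int[k x]_t (g t)%:E)%E.
      move=> a0 b0 f0 g0 mf mg; under eq_integral do rewrite EFinD !EFinM.
      rewrite ge0_integralD//; try exact: measurable_funeM; last 2 first.
      - by move=> t _; rewrite mule_ge0// lee_fin.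
      - by move=> t _; rewrite mule_ge0// lee_fin.
      by rewrite !ge0_integralZl//; move=> *; rewrite lee_fin.
    by move=> x; rewrite /f1 /f2 /= !lin ?mean_parts//; do ?[exact: mpos|exact: mneg].
  - have -> : (fun w => (f1 (Z w, tau i w) + f2 (Z w, tau i w))%:E) = (abse \o (fun w => (u (Z w) * q i w)%:E)).
      apply/funext => w /=; congr EFin; rewrite normrM !norm_posneg /f1 /f2/=; ring.
    by apply: integrable_abse; apply: integrable_mul_sqr.
have cross_q i j : i != j -> (\int[P]_(w in D) (q i w * q j w)%:E = 0)%E.
  move=> ij.
  pose f1 (z : X * (T * T)) := pos phi (z.1, z.2.1) * pos phi (z.1, z.2.2)
     + neg phi (z.1, z.2.1) * neg phi (z.1, z.2.2).
  pose f2 (z : X * (T * T)) := pos phi (z.1, z.2.1) * neg phi (z.1, z.2.2)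
     + neg phi (z.1, z.2.1) * pos phi (z.1, z.2.2).
  have m1 : measurable_fun setT (fun z : X * (T * T) => (z.1, z.2.1)).
    apply: measurable_fun_pair => //.
    by apply: (measurableT_comp measurable_fst measurable_snd).
  have m2 : measurable_fun setT (fun z : X * (T * T) => (z.1, z.2.2)).
    apply: measurable_fun_pair => //.
    by apply: (measurableT_comp measurable_snd measurable_snd).
  have mp1 := measurableT_comp (measurable_pos mphi) m1.
  have mp2 := measurableT_comp (measurable_pos mphi) m2.
  have mn1 := measurableT_comp (measurable_neg mphi) m1.
  have mn2 := measurableT_comp (measurable_neg mphi) m2.
  under eq_integral => w _.
    have -> : q i w * q j w = f1 (Z w, (tau i w, tau j w)) - f2 (Z w, (tau i w, tau j w)).
      exact: mul_posneg.
    over.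
  apply: (integral_freeze_centered mZ mE (k := pair_ker k)
    (@measurable_prod_measurableType _ _ T T)).
  - move=> _ _ [U mU [V1 mV1 <-]] [U' mU' [V1' mV1' <-]]; rewrite -setXI.
    exists (U `&` U'); first exact: measurableI.
    by exists (V1 `&` V1') => //; exact: measurableI.
  - by exists setT => //; exists setT => //; rewrite setXTT.
  - exact: measurable_fun_pair.
  - by move=> A _ mA [U mU [V1 mV1 <-]] AE; exact: law_pair.
  - by apply: measurable_funD; apply: measurable_funM.
  - by apply: measurable_funD; apply: measurable_funM.
  - by move=> z; rewrite addr_ge0// mulr_ge0.
  - by move=> z; rewrite addr_ge0// mulr_ge0.
  - have mpos x : measurable_fun setT (fun t => (pos phi (x, t))%:E).
      apply/measurable_EFinP; apply: (measurableT_comp (measurable_pos mphi)).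
      exact: pair1_measurable.
    have mneg x : measurable_fun setT (fun t => (neg phi (x, t))%:E).
      apply/measurable_EFinP; apply: (measurableT_comp (measurable_neg mphi)).
      exact: pair1_measurable.
    have lin x (f g f' g' : T -> R) :
        (forall t, 0 <= f t) -> (forall t, 0 <= g t) ->
        (forall t, 0 <= f' t) -> (forall t, 0 <= g' t) ->
        measurable_fun setT (EFin \o f) -> measurable_fun setT (EFin \o g) ->
        measurable_fun setT (EFin \o f') -> measurable_fun setT (EFin \o g') ->
        (\int[pair_ker k x]_z (f z.1 * g z.2 + f' z.1 * g' z.2)%:E =
         \int[k x]_t (f t)%:E * \int[k x]_t (g t)%:E
         + \int[k x]_t (f' t)%:E * \int[k x]_t (g' t)%:E)%E.
      move=> f0 g0 f'0 g'0 mf mg mf' mg'.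
      under eq_integral do rewrite EFinD !EFinM.
      rewrite ge0_integralD//; last 4 first.
      - by move=> z _; rewrite mule_ge0// lee_fin.
      - by apply: emeasurable_funM; [apply: (measurableT_comp mf)|apply: (measurableT_comp mg)].
      - by move=> z _; rewrite mule_ge0// lee_fin.
      - by apply: emeasurable_funM; [apply: (measurableT_comp mf')|apply: (measurableT_comp mg')].
      rewrite (pair_kerM k x (a := EFin \o f) (b := EFin \o g))//.
      by rewrite (pair_kerM k x (a := EFin \o f') (b := EFin \o g')).
    move=> x; rewrite /f1 /f2 /=.
    rewrite (lin x (fun t => pos phi (x, t)) (fun t => pos phi (x, t))
      (fun t => neg phi (x, t)) (fun t => neg phi (x, t)))//;
      do ?[exact: mpos|exact: mneg].
    rewrite (lin x (fun t => pos phi (x, t)) (fun t => neg phi (x, t))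
      (fun t => neg phi (x, t)) (fun t => pos phi (x, t)))//;
      do ?[exact: mpos|exact: mneg].
    by rewrite mean_parts.
  - have -> : (fun w => (f1 (Z w, (tau i w, tau j w)) + f2 (Z w, (tau i w, tau j w)))%:E) = (abse \o (fun w => (q i w * q j w)%:E)).
      apply/funext => w /=; congr EFin; rewrite normrM !norm_posneg /f1 /f2/=; ring.
    by apply: integrable_abse; apply: integrable_mul_sqr.
(* The part [u] determined by [Z] is one more term of the orthogonal sum. *)
pose y (p : 'I_n.+1) w := oapp (fun i => c * q i w) (u (Z w)) (unlift ord0 p).
have y0 w : y ord0 w = u (Z w) by rewrite /y unlift_none.
have yS i w : y (lift ord0 i) w = c * q i w by rewrite /y liftK.
have cq2 i : (\int[P]_(w in D) ((c * q i w) ^+ 2)%:E = (c ^+ 2)%:E * SV)%E.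
  under eq_integral do rewrite exprMn EFinM.
  rewrite ge0_integralZl ?qV ?lee_fin ?sqr_ge0//.
  - by apply/measurable_EFinP; exact: measurable_funX.
  - by move=> w _; rewrite lee_fin sqr_ge0.
under eq_integral => w _.
  have -> : c * (\sum_(i < n) phi (Z w, tau i w)) + u (Z w) = \sum_(p < n.+1) y p w.
    rewrite big_ord_recl y0 addrC mulr_sumr; congr (_ + _).
    by apply: eq_bigr => i _; rewrite yS.
  over.
rewrite integral_sqr_sum_orthogonal//.
- rewrite big_ord_recl; under eq_integral do rewrite y0.
  rewrite addeC leeD2r//.
  under eq_bigr => i _.
    under eq_integral do rewrite yS.
    rewrite cq2; over.
  have SVfin : SV \is a fin_num by rewrite ge0_fin_numE.
  rewrite -(fineK SVfin) /= -!EFinM sumEFin lee_fin sumr_const card_ord -mulr_natl.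
  by rewrite /c expr2 !mulrA mulfV ?mul1r// pnatr_eq0 -lt0n.
- move=> p; case: (unliftP ord0 p) => [i ->|->].
    have -> : y (lift ord0 i) = (fun w => c * q i w) by apply/funext => w.
    exact: measurable_funM.
  by have -> : y ord0 = (u \o Z) by apply/funext => w.
- move=> p; case: (unliftP ord0 p) => [i ->|->].
    under eq_integral do rewrite yS.
    by rewrite cq2 lte_mul_pinfty// lee_fin sqr_ge0.
  by under eq_integral do rewrite y0.
- have cz f : P.-integrable D (EFin \o f) -> (\int[P]_(w in D) (f w)%:E = 0)%E -> forall a, (\int[P]_(w in D) (a * f w)%:E = 0)%E.
    move=> fi f0 a; under eq_integral do rewrite EFinM.
    by rewrite (integralZl mD fi) f0 mule0.
  move=> p r; case: (unliftP ord0 p) => [i ->|->]; case: (unliftP ord0 r) => [j ->|->] pr.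
  + under eq_integral do rewrite !yS mulrACA.
    apply: cz; first exact: integrable_mul_sqr.
    by apply: cross_q; apply: contraNN pr => /eqP ->.
  + under eq_integral do rewrite yS y0 -mulrA (mulrC (q _ _)).
    by apply: cz; [exact: integrable_mul_sqr|exact: cross_u].
  + under eq_integral do rewrite yS y0 mulrCA.
    by apply: cz; [exact: integrable_mul_sqr|exact: cross_u].
  + by rewrite eqxx in pr.
Qed.

End iid_samples.

Section iid_vectors.
Context d0 d1 d2 (Omega : measurableType d0) (X : measurableType d1)
  (T : measurableType d2) (R : realType) (d : nat).
Variables (P : probability Omega R) (Z : Omega -> X) (E : set X).
Variables (k : R.-pker X ~> T) (n : nat) (tau : 'I_n -> Omega -> T).
Hypotheses (mZ : measurable_fun setT Z) (mE : measurable E).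
Hypothesis mtau : forall i, measurable_fun setT (tau i).
Hypothesis iid : forall A (U : 'I_n -> set T), measurable A -> A `<=` E ->
  (forall i, measurable (U i)) ->
  (P (Z @^-1` A `&` \bigcap_(i in [set: 'I_n]) tau i @^-1` U i) =
   \int[P]_(w in Z @^-1` A) (\prod_(i < n) fine (k (Z w) (U i)))%:E)%E.
Variables (phi : X * T -> 'rV[R]_d) (u : X -> 'rV[R]_d) (s : X -> R).
Hypotheses (mphi : measurable_rV phi) (mu : measurable_rV u)
  (ms : measurable_fun setT s).
Hypothesis phi0 : forall x c, (\int[k x]_t (phi (x, t) 0 c)%:E = 0)%E.
Hypothesis phis : forall x, (\int[k x]_t (enorm (phi (x, t)) ^+ 2)%:E <= (s x)%:E)%E.
Local Notation D := (Z @^-1` E).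

Lemma conditional_variance_rV_le : (0 < n)%N ->
  (\int[P]_(w in D)
     (enorm (n%:R^-1 *: (\sum_(i < n) phi (Z w, tau i w)) + u (Z w)) ^+ 2)%:E
   <= \int[P]_(w in D) (n%:R^-1 * s (Z w) + enorm (u (Z w)) ^+ 2)%:E)%E.
Proof.
move=> n0.
have mD : measurable D by rewrite -[_ @^-1` _]setTI; exact: mZ.
have s0 x : 0 <= s x.
  by rewrite -lee_fin (le_trans _ (phis x))// integral_ge0// => t _; rewrite lee_fin sqr_ge0.
have n'0 : 0 <= n%:R^-1 :> R by rewrite invr_ge0 ler0n.
have mphiZ c (i : 'I_n) : measurable_fun D (fun w => phi (Z w, tau i w) 0 c).
  apply: measurable_funTS; apply: (measurableT_comp (mphi c)).
  exact: measurable_fun_pair.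
have muZ c : measurable_fun D (fun w => u (Z w) 0 c).
  by apply: measurable_funTS; exact: (measurableT_comp (mu c)).
have mc c : measurable_fun D (fun w => (n%:R^-1 * (\sum_(i < n) phi (Z w, tau i w) 0 c) + u (Z w) 0 c) ^+ 2).
  apply: measurable_funX; apply: measurable_funD => //; apply: measurable_funM => //.
  by apply: measurable_sum => i; exact: mphiZ.
have mphi2 c : measurable_fun setT (fun z => (phi z 0 c ^+ 2)%:E).
  by apply/measurable_EFinP; exact: measurable_funX.
pose V c x := (\int[k x]_t (phi (x, t) 0 c ^+ 2)%:E)%E.
have V0 c x : (0 <= V c x)%E by apply: integral_ge0 => t _; rewrite lee_fin sqr_ge0.
have mV c : measurable_fun D (V c \o Z).
  apply: measurable_funTS; apply: measurableT_comp mZ.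
  by apply: (measurable_fun_integral_finite_kernel (fun z => (phi z 0 c ^+ 2)%:E) k) => // z;
    rewrite lee_fin sqr_ge0.
have T0 c w : (0 <= n%:R^-1%:E * V c (Z w) + (u (Z w) 0 c ^+ 2)%:E)%E.
  by apply: adde_ge0; rewrite ?lee_fin ?sqr_ge0//; apply: mule_ge0; [rewrite lee_fin|exact: V0].
under eq_integral => w _.
  rewrite sqr_enorm -sumEFin.
  under eq_bigr do rewrite !mxE summxE.
  over.
rewrite ge0_integral_sum//; last 2 first.
- by move=> c; apply/measurable_EFinP; exact: mc.
- by move=> c w _; rewrite lee_fin sqr_ge0.
apply: (@le_trans _ _ (\sum_(c < d) \int[P]_(w in D)
    (n%:R^-1%:E * V c (Z w) + (u (Z w) 0 c ^+ 2)%:E))%E).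
  apply: lee_sum => c _.
  exact: (@conditional_variance_le _ _ _ _ _ _ _ P Z E k n tau mZ mE mtau iid
    (fun z => phi z 0 c) (fun x => u x 0 c)).
rewrite -ge0_integral_sum//; last first.
- move=> c; apply: emeasurable_funD; first by apply: measurable_funeM; exact: mV.
  by apply/measurable_EFinP; exact: measurable_funX.
have sumV x : (\sum_(c < d) V c x <= (s x)%:E)%E.
  apply: le_trans (phis x); rewrite -ge0_integral_sum//; last 2 first.
  - by move=> c; apply: (measurableT_comp (mphi2 c)); exact: pair1_measurable.
  - by move=> c t _; rewrite lee_fin sqr_ge0.
  by under eq_integral do rewrite sumEFin -sqr_enorm.
apply: ge0_le_integral => //.
- by move=> w _; apply: sume_ge0 => c _; exact: T0.
- apply: emeasurable_sum => c; apply: emeasurable_funD; first by apply: measurable_funeM; exact: mV.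
  by apply/measurable_EFinP; exact: measurable_funX.
- apply/measurable_EFinP; apply: measurable_funD.
    apply: measurable_funM => //; apply: measurable_funTS; exact: measurableT_comp.
  under eq_fun do rewrite sqr_enorm.
  by apply: measurable_sum => c; exact: measurable_funX.
- move=> w _; rewrite big_split/= EFinD leeD//.
    rewrite -ge0_sume_distrr//.
    by rewrite EFinM lee_wpmul2l ?lee_fin//; exact: sumV.
  by rewrite sumEFin lee_fin -sqr_enorm.
Qed.

End iid_vectors.

(** * Measurability and moments of the trajectory gradient *)

Section kernel_of_laws.
Context d1 d2 (X : measurableType d1) (T : measurableType d2) (R : realType).
Variable m : X -> probability T R.

Definition family_pker of (forall U, measurable U -> measurable_fun setT (fun x => m x U)) :=
  fun x => m x : {measure set T -> \bar R}.

Variable mm : forall U, measurable U -> measurable_fun setT (fun x => m x U).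

HB.instance Definition _ := isKernel.Build _ _ X T R (family_pker mm) mm.

Let family_pker_prob x : family_pker mm x setT = 1%E.
Proof. exact: probability_setT. Qed.

HB.instance Definition _ :=
  Kernel_isProbability.Build _ _ X T R (family_pker mm) family_pker_prob.

End kernel_of_laws.

Section joint_measurability.
Context d1 d2 (S : measurableType d1) (A : measurableType d2) (R : realType).
Variables (M : mdp S A R) (d : nat) (pi : policy S A R d).
Variables (e : estimator) (b : S * A -> R) (hb : measurable_fun setT b).
Variables (L Lg : R).
Hypotheses (hA2 : bounded_log_derivatives M pi) (hL : grad_lipschitz M pi L)
  (hLg : traj_grad_lipschitz M pi e b Lg).
Context d3 (X : measurableType d3).
Implicit Types (tau : X -> traj M) (theta : X -> 'rV[R]_d).

Lemma measurable_logpdf th0 :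
  measurable_fun setT (fun z : S * A => logpdf pi z th0).
Proof. by apply: measurableT_comp => //; exact: measurable_policy_pdf. Qed.

Lemma measurable_policy_pdf_param (z : X -> S * A) theta :
  measurable_fun setT z -> measurable_rV theta ->
  measurable_fun setT (fun w => policy_pdf pi (theta w) (z w)).
Proof.
move=> mz mth; have [G [CH [Rm [_ [hG _ _]]]]] := hA2.
rewrite (_ : (fun w => _) = expR \o (fun w => logpdf pi (z w) (theta w))).
  apply: measurableT_comp => //.
  apply: (@measurable_caratheodory _ _ _ _ _ _ (logpdf pi) G) => //.
    exact: measurable_logpdf.
  by move=> t x y; apply: partial_lipschitz => x' i; exact: hG.
by apply/funext => w /=; rewrite /logpdf lnK// posrE policy_pdf_gt0.
Qed.

Lemma measurable_importance_weight_param tau theta theta' :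
  measurable_fun setT tau -> measurable_rV theta -> measurable_rV theta' ->
  measurable_fun setT (fun w => importance_weight pi (tau w) (theta w) (theta' w)).
Proof.
move=> mt m1 m2.
have mlik th : measurable_rV th ->
    measurable_fun setT (fun w => likelihood pi (th w) (tau w)).
  move=> mth; apply: measurable_prod => t _; apply: measurable_policy_pdf_param => //.
  exact: (measurableT_comp (measurable_tnth t) mt).
apply: measurable_funM; first exact: mlik.
apply: measurable_fun_inv_pos; last exact: mlik.
by move=> w; rewrite prodr_gt0// => t _; exact: policy_pdf_gt0.
Qed.

Lemma measurable_score th0 c :
  measurable_fun setT (fun z : S * A => score pi th0 z 0 c).
Proof.
have [G [CH [Rm [_ [hG _ _]]]]] := hA2.
under eq_fun do rewrite mxE.
apply: measurable_partial => [y|t]; first exact: measurable_logpdf.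
by have [] := hG th0 t c.
Qed.

Lemma measurable_traj_grad th0 c :
  measurable_fun setT (fun t : traj M => traj_grad pi e b t th0 0 c).
Proof.
have mr (t : 'I_(horizon M)) : measurable_fun setT (fun tr : traj M =>
    discount M ^+ t * reward M (tnth tr t) - b (tnth tr t)).
  apply: measurable_funB.
    apply: measurable_funM => //; apply: measurableT_comp; first exact: measurable_reward.
    exact: measurable_tnth.
  exact: (measurableT_comp hb (measurable_tnth t)).
have msc (t : 'I_(horizon M)) : measurable_fun setT (fun tr : traj M =>
    score pi th0 (tnth tr t) 0 c).
  exact: (measurableT_comp (measurable_score th0 c) (measurable_tnth t)).
rewrite /traj_grad; case: e.
  under eq_fun do rewrite mxE summxE.
  by apply: measurable_funM; apply: measurable_sum.
under eq_fun do rewrite summxE.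
apply: measurable_sum => t.
under eq_fun do rewrite mxE summxE.
apply: measurable_funM => //.
rewrite (_ : (fun _ => _) = (fun tr : traj M => \sum_(i < horizon M)
    (if (i <= t)%N then score pi th0 (tnth tr i) 0 c else 0))); last first.
  by apply/funext => tr; rewrite big_mkcond.
by apply: measurable_sum => i; case: (i <= t)%N.
Qed.

Lemma coord_lipschitz (f : 'rV[R]_d -> 'rV[R]_d) (C : R) :
  (forall x y, enorm (f x - f y) <= C * enorm (x - y)) ->
  forall c x y, `|f x 0 c - f y 0 c| <= `|C| * l1 (x - y).
Proof.
move=> fC c x y; have := coord_le_enorm (f x - f y) c; rewrite !mxE => h.
apply: (le_trans h); apply: (le_trans (fC x y)).
apply: (le_trans (ler_wpM2r (enorm_ge0 _) (ler_norm C))).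
by rewrite ler_wpM2l// enorm_le_l1.
Qed.

Lemma measurable_traj_grad_param tau theta :
  measurable_fun setT tau -> measurable_rV theta ->
  measurable_rV (fun w => traj_grad pi e b (tau w) (theta w)).
Proof.
move=> mt mth c.
apply: (@measurable_caratheodory _ _ _ _ _ _
  (fun t th => traj_grad pi e b t th 0 c) `|Lg|) => //.
  by move=> x; exact: measurable_traj_grad.
by move=> t x y; apply: (@coord_lipschitz (traj_grad pi e b t)); exact: hLg.
Qed.

Lemma measurable_grad_param theta :
  measurable_rV theta -> measurable_rV (fun w => grad (objective M pi) (theta w)).
Proof.
move=> mth c.
apply: (@measurable_caratheodory _ _ _ _ _ unit
  (fun _ th => grad (objective M pi) th 0 c) `|L| (fun=> tt)) => //.
by move=> _ x y; exact: coord_lipschitz.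
Qed.

End joint_measurability.

Section measurable_law.
Context d1 d2 (S : measurableType d1) (A : measurableType d2) (R : realType).
Variables (M : mdp S A R) (d : nat) (pi : policy S A R d).
Hypothesis hA2 : bounded_log_derivatives M pi.
Context d3 (X : measurableType d3).

(** The laws are densities [importance_weight _ 0 theta] with respect to the
    single law of parameter [0], and the weight is jointly measurable. *)
Lemma measurable_traj_law (theta : X -> 'rV[R]_d) U :
  measurable_rV theta -> measurable U ->
  measurable_fun setT (fun w => traj_law M pi (theta w) U).
Proof.
move=> mth mU.
have wE w : traj_law M pi (theta w) U = (\int[traj_law M pi 0]_y
    ((importance_weight pi y 0 (theta w))%:E * (\1_U y)%:E))%E.
  rewrite -ge0_integral_traj_law.
  - by rewrite integral_indic// setIT.
  - by move=> y; rewrite lee_fin.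
  - by apply/measurable_EFinP; exact: measurable_indic.
under eq_fun do rewrite wE.
apply: (@measurable_fun_fubini_tonelli_F _ _ X (traj M) R (traj_law M pi 0)
  (fun z => (importance_weight pi z.2 0 (theta z.1))%:E * (\1_U z.2)%:E)%E).
- apply: emeasurable_funM; apply/measurable_EFinP.
    apply: (measurable_importance_weight_param hA2) => // c.
    by apply: (measurableT_comp (mth c)).
  have mi : measurable_fun setT (\1_U : traj M -> R) by exact: measurable_indic.
  by apply: (measurableT_comp mi).
- by move=> z; rewrite mule_ge0// lee_fin importance_weight_ge0.
Qed.

End measurable_law.

Section centering.
Context d1 (T : measurableType d1) (R : realType) (P : probability T R).

Lemma integral_probability_cst (r : R) : (\int[P]_t r%:E = r%:E)%E.
Proof.
rewrite integral_cst// -[RHS]mule1; congr (_ * _)%E.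
exact: probability_setT.
Qed.

(** An integral of the form [+oo - +oo] is infinite by convention, so a finite
    value forces both parts to be finite. *)
Lemma finite_integral_integrable (f : T -> R) (m : R) : measurable_fun setT f ->
  (\int[P]_t (f t)%:E = m%:E)%E -> P.-integrable setT (EFin \o f).
Proof.
move=> mf; have mf' : measurable_fun setT (EFin \o f) by exact/measurable_EFinP.
rewrite integralE => fm; apply/integrableP; split => //.
rewrite (eq_integral (fun t => (EFin \o f)^\+ t + (EFin \o f)^\- t)%E); last first.
  by move=> t _; have /(congr1 (@^~ t)) := fune_abse (EFin \o f).
rewrite ge0_integralD//; last 2 first.
- exact: measurable_funepos.
- exact: measurable_funeneg.
set a := (\int[P]_x (EFin \o f)^\+ x)%E; set c := (\int[P]_x (EFin \o f)^\- x)%E.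
have a0 : (0 <= a)%E by apply: integral_ge0.
have c0 : (0 <= c)%E by apply: integral_ge0.
move: fm; rewrite -/a -/c; clearbody a c.
by move: a c a0 c0 => [a| |] [c| |]//= _ _ _; rewrite -EFinD ltry.
Qed.

Lemma centered_mean (f : T -> R) (m : R) : measurable_fun setT f ->
  (\int[P]_t (f t)%:E = m%:E)%E -> (\int[P]_t (f t - m)%:E = 0)%E.
Proof.
move=> mf fm; have fi := finite_integral_integrable mf fm.
under eq_integral do rewrite EFinB.
rewrite (integralB_EFin _ fi) ?fm ?integral_probability_cst ?subee//.
exact: finite_measure_integrable_cst.
Qed.

(** [E (f - m)^2 + m^2 = E f^2]; only one inequality is claimed so that nothing is
    required of [f] when [E f^2] is infinite. *)
Lemma centered_moment_le (f : T -> R) (m : R) : measurable_fun setT f ->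
  (\int[P]_t (f t)%:E = m%:E)%E ->
  (\int[P]_t ((f t - m) ^+ 2)%:E + (m ^+ 2)%:E <= \int[P]_t (f t ^+ 2)%:E)%E.
Proof.
move=> mf fm.
have [foo|] := ltP (\int[P]_t (f t ^+ 2)%:E)%E +oo%E; last first.
  by rewrite leye_eq => /eqP ->; rewrite leey.
have icst (r : R) : P.-integrable setT (fun _ => r%:E).
  exact: finite_measure_integrable_cst.
have fi := finite_integral_integrable mf fm.
have fmi : P.-integrable setT (fun t => ((f t - m) ^+ 2)%:E).
  have fmoo : (\int[P]_t ((f t - m) ^+ 2)%:E < +oo)%E.
    apply: (@le_lt_trans _ _ (\int[P]_t (2%:E * (f t ^+ 2)%:E + (2 * m ^+ 2)%:E))%E).
      apply: ge0_le_integral => //.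
      - by move=> t _; rewrite lee_fin sqr_ge0.
      - by apply/measurable_EFinP; apply: measurable_funX; exact: measurable_funB.
      - apply: emeasurable_funD => //; apply: measurable_funeM; apply/measurable_EFinP.
        exact: measurable_funX.
      - move=> t _; rewrite -EFinM -EFinD lee_fin.
        have := sqr_ge0 (f t + m); nra.
    rewrite ge0_integralD//; last 3 first.
    - by move=> t _; rewrite -EFinM lee_fin mulr_ge0// sqr_ge0.
    - by apply: measurable_funeM; apply/measurable_EFinP; exact: measurable_funX.
    - by move=> t _; rewrite lee_fin mulr_ge0// sqr_ge0.
    rewrite integral_probability_cst ge0_integralZl//; last 2 first.
    - by apply/measurable_EFinP; exact: measurable_funX.
    - by move=> t _; rewrite lee_fin sqr_ge0.
    by rewrite lte_add_pinfty ?ltry// lte_mul_pinfty.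
  by apply: ge0_integrable => // [|t];
    [apply: measurable_funX; exact: measurable_funB|exact: sqr_ge0].
have -> : (\int[P]_t (f t ^+ 2)%:E = \int[P]_t (((f t - m) ^+ 2)%:E + ((2 * m)%:E * (f t)%:E + (- m ^+ 2)%:E)))%E.
  by apply: eq_integral => t _; rewrite -EFinM -!EFinD; congr (_%:E); ring.
rewrite integralD//; last first.
  by apply: integrableD => //; exact: integrableZl.
rewrite leeD2l// integralD//; last exact: integrableZl.
rewrite integralZl// fm integral_probability_cst -EFinM -EFinD lee_fin.
by rewrite le_eqVlt; apply/orP; left; apply/eqP; ring.
Qed.

Lemma centered_moment_rV_le d (f : T -> 'rV[R]_d) (m : 'rV[R]_d) :
  measurable_rV f -> (forall c, \int[P]_t (f t 0 c)%:E = (m 0 c)%:E)%E ->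
  (\int[P]_t (enorm (f t - m) ^+ 2)%:E <= \int[P]_t (enorm (f t) ^+ 2)%:E)%E.
Proof.
move=> mf fm.
under eq_integral do rewrite sqr_enorm -sumEFin.
under [leRHS]eq_integral do rewrite sqr_enorm -sumEFin.
have mfm c : measurable_fun setT (fun t => (f t - m) 0 c).
  by under eq_fun do rewrite !mxE; exact: measurable_funB.
rewrite !ge0_integral_sum//; last 4 first.
- by move=> c; apply/measurable_EFinP; exact: measurable_funX.
- by move=> c t _; rewrite lee_fin sqr_ge0.
- by move=> c; apply/measurable_EFinP; exact: measurable_funX.
- by move=> c t _; rewrite lee_fin sqr_ge0.
apply: lee_sum => c _; under eq_integral do rewrite !mxE.
by apply: le_trans (centered_moment_le (mf c) (fm c)); rewrite leeDl// lee_fin sqr_ge0.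
Qed.

End centering.

Section moments.
Context d1 d2 (S : measurableType d1) (A : measurableType d2) (R : realType).
Variables (M : mdp S A R) (d : nat) (pi : policy S A R d).
Variables (e : estimator) (b : S * A -> R) (hb : measurable_fun setT b).
Variables (sigma Lg Gamma alpha_w : R).
Hypotheses (hA1 : unbiased M pi e b) (hA2 : bounded_log_derivatives M pi)
  (hA3 : bounded_variance M pi e b sigma)
  (hLg : traj_grad_lipschitz M pi e b Lg)
  (hGamma : traj_grad_bounded M pi e b Gamma)
  (halpha : weight_lipschitz M pi alpha_w).
Local Notation J := (objective M pi).
Local Notation g := (@traj_grad _ _ S A R M d pi e b).
Local Notation p := (traj_law M pi).
Local Notation Q := (Qconst Lg Gamma alpha_w).
Implicit Types x y : 'rV[R]_d.

Let mg x c := measurable_traj_grad e hb hA2 x c.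

Lemma traj_grad_coord_bounded t x c : (g t x 0 c) ^+ 2 <= Gamma.
Proof.
apply: le_trans (hGamma t x); rewrite -(real_normK (num_real _)).
by rewrite ler_pXn2r// ?nnegrE ?enorm_ge0// coord_le_enorm.
Qed.

Lemma mean_traj_grad x c : (\int[p x]_t (g t x 0 c)%:E = (grad J x 0 c)%:E)%E.
Proof. by have [_ /(_ x c)] := hA1; rewrite unlock. Qed.

(** Importance sampling only rewrites integrals of nonnegative functions, hence
    the passage through positive and negative parts. *)
Lemma mean_weighted_traj_grad x y c :
  (\int[p x]_t (importance_weight pi t x y * g t y 0 c)%:E = (grad J y 0 c)%:E)%E.
Proof.
have scale_pos (a r : R) : 0 <= a -> (a%:E * maxe r%:E 0 = maxe (a * r)%:E 0)%E.
  by move=> a0; rewrite EFinM maxe_pMr ?lee_fin// mule0.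
have scale_neg (a r : R) : 0 <= a -> (a%:E * maxe (- r%:E) 0 = maxe (- (a * r)%:E) 0)%E.
  by move=> a0; rewrite -!EFinN scale_pos// mulrN.
rewrite -mean_traj_grad integralE [RHS]integralE.
have mf : measurable_fun setT (fun t : traj M => (g t y 0 c)%:E).
  by apply/measurable_EFinP; exact: mg.
have w0 t := importance_weight_ge0 pi t x y.
have hp : (\int[p x]_t ((fun t => (importance_weight pi t x y * g t y 0 c)%:E)^\+)%E t =
    \int[p y]_t ((fun t => (g t y 0 c)%:E)^\+)%E t)%E.
  apply/esym; rewrite (@ge0_integral_traj_law _ _ S A R M d pi x y) //; last first.
    exact: measurable_funepos.
  apply: eq_integral => t _.
  by rewrite !funeposE; exact: scale_pos.
have hn : (\int[p x]_t ((fun t => (importance_weight pi t x y * g t y 0 c)%:E)^\-)%E t =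
    \int[p y]_t ((fun t => (g t y 0 c)%:E)^\-)%E t)%E.
  have fn0 t : (0 <= ((fun t => (g t y 0 c)%:E)^\-)%E t)%E by exact: funeneg_ge0.
  have := @ge0_integral_traj_law _ _ S A R M d pi x y _ fn0 (measurable_funeneg mf).
  move=> ->; apply: eq_integral => t _.
  by rewrite !funenegE scale_neg.
by rewrite hp hn.
Qed.

Lemma measurable_sqr_enorm d3 (X : measurableType d3) (f : X -> 'rV[R]_d) :
  measurable_rV f -> measurable_fun setT (fun w => enorm (f w) ^+ 2).
Proof.
move=> mf; under eq_fun do rewrite sqr_enorm.
by apply: measurable_sum => c; exact: measurable_funX.
Qed.

(** [g(x) - w g(y) = (g(x) - g(y)) + (1 - w) g(y)], where the first part is
    Lipschitz and the second is controlled by the variance of the weight [w]. *)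
Lemma weighted_difference_moment x y :
  (\int[p x]_t (enorm (g t x - importance_weight pi t x y *: g t y) ^+ 2)%:E
   <= (Q * enorm (x - y) ^+ 2)%:E)%E.
Proof.
set D2 := enorm (x - y) ^+ 2.
have D20 : 0 <= D2 by exact: sqr_ge0.
pose V (t : traj M) := (`|1 - importance_weight pi t x y| ^+ 2)%R.
have mV : measurable_fun setT V.
  apply: measurable_funX; apply: measurableT_comp => //; apply: measurable_funB => //.
  exact: measurable_importance_weight.
have Gamma0 : 0 <= Gamma.
  have t : traj M by exact: point.
  exact: le_trans (sqr_ge0 _) (hGamma t x).
have bound t : enorm (g t x - importance_weight pi t x y *: g t y) ^+ 2
    <= 2 * Lg ^+ 2 * D2 + 2 * Gamma * V t.
  have -> : g t x - importance_weight pi t x y *: g t y =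
      (g t x - g t y) + (1 - importance_weight pi t x y) *: g t y.
    by rewrite scalerBl scale1r addrA subrK.
  apply: (le_trans (sqr_enormD_le _ _)); rewrite lerD//.
    rewrite -mulrA ler_wpM2l// -exprMn.
    rewrite ler_pXn2r ?nnegrE ?enorm_ge0//.
    exact: le_trans (enorm_ge0 _) (hLg t x y).
  rewrite sqr_enormZ -mulrA ler_wpM2l// /V real_normK ?num_real// mulrC.
  by rewrite ler_wpM2r ?sqr_ge0//; exact: hGamma.
apply: (@le_trans _ _ (\int[p x]_t ((2 * Lg ^+ 2 * D2)%:E + (2 * Gamma)%:E * (V t)%:E))%E).
  apply: ge0_le_integral => //.
  - by move=> t _; rewrite lee_fin sqr_ge0.
  - apply/measurable_EFinP; apply: measurable_sqr_enorm => c.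
    under eq_fun do rewrite !mxE.
    apply: measurable_funB; first exact: mg.
    by apply: measurable_funM; [exact: measurable_importance_weight|exact: mg].
  - by apply: emeasurable_funD => //; apply: measurable_funeM; exact/measurable_EFinP.
  - by move=> t _; rewrite -EFinM -EFinD lee_fin.
rewrite ge0_integralD//; last 3 first.
- by move=> t _; rewrite lee_fin mulr_ge0// mulr_ge0// sqr_ge0.
- by move=> t _; rewrite -EFinM lee_fin; apply: mulr_ge0; [exact: mulr_ge0|exact: sqr_ge0].
- by apply: measurable_funeM; exact/measurable_EFinP.
rewrite integral_probability_cst.
rewrite ge0_integralZl//; last 3 first.
- exact/measurable_EFinP.
- by move=> t _; rewrite lee_fin sqr_ge0.
- by rewrite lee_fin mulr_ge0.
have := halpha x y; rewrite unlock => hV.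
have G20 : (0 <= (2 * Gamma)%:E)%E by rewrite lee_fin mulr_ge0.
apply: (le_trans (leeD (lexx _) (lee_wpmul2l G20 hV))).
rewrite -EFinM -EFinD lee_fin /Qconst -/D2 le_eqVlt; apply/orP; left; apply/eqP; ring.
Qed.

(** The gradient is the mean of a bounded estimator. *)
Lemma sqr_grad_le x : enorm (grad J x) ^+ 2 <= d%:R * Gamma.
Proof.
rewrite sqr_enorm -[d in d%:R]card_ord -sum1_card natr_sum mulr_suml ler_sum// => c _.
rewrite mul1r -lee_fin.
have := centered_moment_le (mg x c) (mean_traj_grad x c).
have : (\int[p x]_t (g t x 0 c ^+ 2)%:E <= Gamma%:E)%E.
  rewrite -(integral_probability_cst (p x) Gamma); apply: ge0_le_integral => //.
  - by move=> t _; rewrite lee_fin sqr_ge0.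
  - by apply/measurable_EFinP; apply: measurable_funX; exact: mg.
  - by move=> t _; rewrite lee_fin traj_grad_coord_bounded.
move=> h1 h2; apply: le_trans h1; apply: le_trans h2.
by rewrite leeDr// integral_ge0// => t _; rewrite lee_fin sqr_ge0.
Qed.

End moments.

(** * Second moments along a run *)

Lemma ge0_le_integral_partition d0 (T : measurableType d0) (R : realType)
    (mu : {measure set T -> \bar R}) (F : (set T)^nat) (f h : T -> R) :
  (forall n, measurable (F n)) -> trivIset setT F -> \bigcup_n F n = setT ->
  measurable_fun setT f -> measurable_fun setT h ->
  (forall x, 0 <= f x) -> (forall x, 0 <= h x) ->
  (forall n, \int[mu]_(x in F n) (f x)%:E <= \int[mu]_(x in F n) (h x)%:E)%E ->
  (\int[mu]_x (f x)%:E <= \int[mu]_x (h x)%:E)%E.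
Proof.
move=> mF tF UF mf mh f0 h0 fh; rewrite -UF.
have mU (q : T -> R) : measurable_fun setT q ->
    measurable_fun (\bigcup_n F n) (EFin \o q).
  by move=> mq; rewrite UF; exact/measurable_EFinP.
rewrite !ge0_integral_bigcup//; try (by move=> x _; rewrite lee_fin); try exact: mU.
by apply: lee_nneseries => [n _ _|n _]; [apply: integral_ge0 => x _; rewrite lee_fin|exact: fh].
Qed.

Section run.
Context d1 d2 (S : measurableType d1) (A : measurableType d2) (R : realType).
Variables (M : mdp S A R) (d : nat) (pi : policy S A R d).
Variables (e : estimator) (b : S * A -> R) (hb : measurable_fun setT b).
Variables (sigma L Lg Gamma alpha_w : R).
Hypotheses (hA1 : unbiased M pi e b) (hA2 : bounded_log_derivatives M pi)
  (hA3 : bounded_variance M pi e b sigma)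
  (hL0 : 0 < L) (hL : grad_lipschitz M pi L)
  (hLg : traj_grad_lipschitz M pi e b Lg)
  (hGamma : traj_grad_bounded M pi e b Gamma)
  (halpha0 : 0 < alpha_w) (halpha : weight_lipschitz M pi alpha_w).
Variables (eta eps alpha beta : R) (m B K : nat) (theta0 : 'rV[R]_d).
Hypotheses (heps : 0 < eps) (alpha0 : 0 < alpha) (beta0 : 0 <= beta)
  (m0 : (0 < m)%N) (B0 : (0 < B)%N).
Context d3 (Omega : measurableType d3) (P : probability Omega R).
Variables (theta v : nat -> Omega -> 'rV[R]_d).
Variable tau : nat -> nat -> Omega -> traj M.
Hypothesis hrun :
  abasvrpg_run pi e b sigma eta eps alpha beta m B K theta0 P theta v tau.
Local Notation J := (objective M pi).
Local Notation g := (@traj_grad _ _ S A R M d pi e b).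
Local Notation p := (traj_law M pi).
Local Notation Q := (Qconst Lg Gamma alpha_w).
Local Notation ck := (checkpoint m).
Local Notation N := (adaptive_batch sigma eps alpha beta m v).

Definition past_gen k : set (set Omega) := [set E | exists j i U,
  [/\ (j < k)%N, measurable U & E = tau j i @^-1` U]].

(** The same points as [Omega] with the coarser sigma-algebra [past tau k], so
    that being determined by the past is measurability of a function on it. *)
Definition pastT k : measurableType _ := g_sigma_algebraType (past_gen k).

Lemma measurable_past k E : past tau k E -> measurable E.
Proof.
have s : sigma_algebra [set: Omega] (@measurable _ Omega) by exact: sigma_algebra_measurable.
apply: smallest_sub => // _ [j [i [U [_ mU ->]]]].
by rewrite -[_ @^-1` _]setTI; exact: (run_measurable hrun).
Qed.

Lemma measurable_id_past k : measurable_fun setT (id : Omega -> pastT k).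
Proof. by move=> _ E mE; rewrite setTI; exact: measurable_past mE. Qed.

Lemma measurable_tau k n i : (k < n)%N ->
  measurable_fun setT (tau k i : pastT n -> traj M).
Proof.
by move=> kn _ U mU; rewrite setTI; apply: sub_sigma_algebra; exists k, i, U.
Qed.

Lemma measurable_rV_past k (f : Omega -> 'rV[R]_d) :
  measurable_rV (f : pastT k -> _) -> measurable_rV f.
Proof. by move=> mf c; apply: (measurableT_comp (mf c) (@measurable_id_past k)). Qed.

Lemma checkpoint_le k : (ck k <= k)%N.
Proof. exact: leq_trunc_div. Qed.

Lemma checkpoint_id k : (m %| k)%N -> ck k = k.
Proof. by move=> mk; rewrite /checkpoint divnK. Qed.

Lemma dvdn_checkpoint k : (m %| ck k)%N.
Proof. exact: dvdn_mull. Qed.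

Lemma checkpoint_lt k : ~~ (m %| k)%N -> (ck k < k)%N.
Proof.
move=> mk; rewrite ltn_neqAle checkpoint_le andbT.
by apply: contraNneq mk => <-; exact: dvdn_checkpoint.
Qed.

(** Divided by [alpha], this is the bound on the squared error that the batch size
    of a checkpoint is chosen to guarantee. *)
Definition batch_den k w := beta / m%:R *
       \sum_(ck k - m <= i < ck k) enorm (v i w) ^+ 2 + eps.

Lemma batch_den_gt0 k w : 0 < batch_den k w.
Proof.
rewrite ltr_wpDl// mulr_ge0 ?divr_ge0 ?ler0n//.
by apply: sumr_ge0 => i _; exact: sqr_ge0.
Qed.

Lemma adaptive_batch_gt0 k w : (0 < N k w)%N.
Proof. by rewrite leq_max. Qed.

Lemma adaptive_batch_ge k w : (N k w)%:R^-1 * sigma ^+ 2 <= batch_den k w / alpha.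
Proof.
have D0 := batch_den_gt0 k w.
have N0 : 0 < (N k w)%:R :> R by rewrite ltr0n adaptive_batch_gt0.
rewrite mulrC ler_pdivrMr// mulrAC ler_pdivlMr//.
rewrite -ler_pdivrMl// mulrC (mulrC (sigma ^+ 2)).
apply: (@le_trans _ _ (Num.ceil (alpha * sigma ^+ 2 / batch_den k w))%:~R).
  exact: ceil_ge.
apply: (@le_trans _ _ (`|Num.ceil (alpha * sigma ^+ 2 / batch_den k w)|%N)%:R).
  by rewrite -[leRHS]mulrz_nat natz ler_int ler_norm.
by rewrite ler_nat leq_maxr.
Qed.

Lemma measurable_sqr_sum n s :
  (forall i, i \in s -> measurable_rV (v i : pastT n -> _)) ->
  measurable_fun setT (fun w : pastT n => \sum_(i <- s) enorm (v i w) ^+ 2).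
Proof.
elim: s => [|i s ih] h.
  by under eq_fun do rewrite big_nil; exact: measurable_cst.
under eq_fun do rewrite big_cons; apply: measurable_funD.
  by apply: measurable_sqr_enorm; apply: h; rewrite mem_head.
by apply: ih => j js; apply: h; rewrite in_cons js orbT.
Qed.

Lemma measurable_batch_den n k :
  (forall i, (i < ck k)%N -> measurable_rV (v i : pastT n -> _)) ->
  measurable_fun setT (batch_den k : pastT n -> R).
Proof.
move=> mv; apply: measurable_funD => //; apply: measurable_funM => //.
by apply: measurable_sqr_sum => i; rewrite mem_index_iota => /andP[_ ik]; exact: mv.
Qed.

Lemma measurable_ceil_batch n k z :
  (forall i, (i < ck k)%N -> measurable_rV (v i : pastT n -> _)) ->
  measurable ((fun w : pastT n =>
    Num.ceil (alpha * sigma ^+ 2 / batch_den k w)) @^-1` [set z]).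
Proof.
move=> mv; apply: measurable_ceil_eq; apply: measurable_funM => //.
by apply: measurable_fun_inv_pos; [exact: batch_den_gt0|exact: measurable_batch_den].
Qed.

(** [theta k] is determined by the samples drawn before iteration [k], and [v k]
    by those drawn up to iteration [k]. *)
Lemma measurable_run k : (k <= K.+1)%N -> forall n,
  ((k <= n)%N -> measurable_rV (theta k : pastT n -> _)) /\
  ((k <= K)%N -> (k < n)%N -> measurable_rV (v k : pastT n -> _)).
Proof.
elim/ltn_ind: k => k ih kK n.
have th : (k <= n)%N -> measurable_rV (theta k : pastT n -> _).
  case: k ih kK => [|k] ih kK kn c.
    by under eq_fun do rewrite (run_init hrun); exact: measurable_cst.
  under eq_fun do rewrite (run_update hrun)// !mxE.
  have [h1 h2] := ih k (ltnSn k) (ltnW kK) n.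
  by apply: measurable_funD; [apply: h1; exact: ltnW|apply: measurable_funM => //; exact: h2].
split => // kK' kn.
have {}th := th (ltnW kn).
have mt i := measurable_tau i kn.
have mgt i := measurable_traj_grad_param hb hA2 hLg (mt i) th.
have [mk|mk] := boolP (m %| k)%N.
- have mv i : (i < ck k)%N -> measurable_rV (v i : pastT n -> _).
    rewrite checkpoint_id// => ik; have [_] := ih i ik (ltnW (leq_trans ik kK)) n.
    by apply; [exact: ltnW (leq_trans ik kK')|exact: ltn_trans ik kn].
  move=> c.
  pose F (z : int) (w : pastT n) : R := (maxn 1 `|z|%N)%:R^-1 *
    \sum_(i < maxn 1 `|z|%N) g (tau k i w) (theta k w) 0 c.
  pose Z (w : pastT n) : int := Num.ceil (alpha * sigma ^+ 2 / batch_den k w).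
  rewrite (_ : (fun w => _) = (fun w => F (Z w) w)); last first.
    by apply/funext => w; rewrite (run_checkpoint hrun)// mxE summxE.
  apply: (@measurable_select _ _ (pastT n) R int Z F) => z.
    exact: measurable_ceil_batch.
  by apply: measurable_funM => //; apply: measurable_sum => i; exact: mgt.
- have ckk := checkpoint_lt mk.
  have ckK : (ck k <= K)%N by exact: leq_trans (checkpoint_le k) kK'.
  have [h1 h2] := ih (ck k) ckk (leqW ckK) n.
  have {}h1 := h1 (ltnW (ltn_trans ckk kn)).
  have {}h2 := h2 ckK (ltn_trans ckk kn).
  move=> c; under eq_fun do rewrite (run_inner hrun)// !mxE summxE.
  apply: measurable_funD; last exact: h2.
  apply: measurable_funM => //; apply: measurable_sum => i.
  under eq_fun do rewrite !mxE.
  apply: measurable_funB; first exact: mgt.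
  apply: measurable_funM; first exact: measurable_importance_weight_param.
  exact: (measurable_traj_grad_param hb hA2 hLg).
Qed.

Lemma measurable_theta k n : (k <= K.+1)%N -> (k <= n)%N ->
  measurable_rV (theta k : pastT n -> _).
Proof. by move=> kK kn; exact: (measurable_run kK n).1. Qed.

Lemma measurable_v k n : (k <= K)%N -> (k < n)%N ->
  measurable_rV (v k : pastT n -> _).
Proof. by move=> kK kn; exact: (measurable_run (leqW kK) n).2. Qed.

Lemma measurable_step_law k (kK : (k <= K.+1)%N) U : measurable U ->
  measurable_fun [set: pastT k] (fun w => p (theta k w) U).
Proof. by move=> mU; apply: measurable_traj_law => //; exact: measurable_theta. Qed.

Definition step_ker k (kK : (k <= K.+1)%N) : R.-pker (pastT k) ~> traj M :=
  family_pker (measurable_step_law kK).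

(** [run_sample] in the form used to freeze the past: [id] forgets everything but
    the past. *)
Lemma step_ker_iid k (kK : (k <= K)%N) n (E : set (pastT k)) :
  E `<=` [set w | batch sigma eps alpha beta m B v k w = n] ->
  forall (C : set (pastT k)) (U : 'I_n -> set (traj M)),
  measurable C -> C `<=` E -> (forall i, measurable (U i)) ->
  (P ((id : Omega -> pastT k) @^-1` C `&` \bigcap_(i in [set: 'I_n]) tau k i @^-1` U i) =
   \int[P]_(w in (id : Omega -> pastT k) @^-1` C)
      (\prod_(i < n) fine (step_ker (leqW kK) w (U i)))%:E)%E.
Proof.
move=> En C U mC CE mU.
by rewrite (run_sample hrun kK mC)//; apply: subset_trans En.
Qed.

Definition err k w := v k w - grad J (theta k w).

Lemma measurable_grad_theta k n : (k <= K.+1)%N -> (k <= n)%N ->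
  measurable_rV (fun w : pastT n => grad J (theta k w)).
Proof.
by move=> kK kn; apply: (measurable_grad_param hL); exact: measurable_theta.
Qed.

Lemma measurable_rVB d4 (X : measurableType d4) (f h : X -> 'rV[R]_d) :
  measurable_rV f -> measurable_rV h -> measurable_rV (fun w => f w - h w).
Proof.
by move=> mf mh c; under eq_fun do rewrite !mxE; exact: measurable_funB.
Qed.

Lemma measurable_err k n : (k <= K)%N -> (k < n)%N ->
  measurable_rV (err k : pastT n -> _).
Proof.
move=> kK kn; apply: measurable_rVB; first exact: measurable_v.
by apply: measurable_grad_theta; [exact: leqW|exact: ltnW].
Qed.

Lemma measurable_sqr_rV_past n (f : Omega -> 'rV[R]_d) :
  measurable_rV (f : pastT n -> _) ->
  measurable_fun [set: Omega] (fun w => enorm (f w) ^+ 2).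
Proof. by move=> mf; apply: measurable_sqr_enorm; exact: measurable_rV_past mf. Qed.

Lemma measurable_sqr_err k : (k <= K)%N ->
  measurable_fun [set: Omega] (fun w => enorm (err k w) ^+ 2).
Proof. by move=> kK; apply: (@measurable_sqr_rV_past k.+1); exact: measurable_err. Qed.

Lemma measurable_sqr_v k : (k <= K)%N ->
  measurable_fun [set: Omega] (fun w => enorm (v k w) ^+ 2).
Proof. by move=> kK; apply: (@measurable_sqr_rV_past k.+1); exact: measurable_v. Qed.

Lemma measurable_batch_event k n : (k <= K)%N -> (m %| k)%N ->
  measurable ([set w | N k w = n] : set (pastT k)).
Proof.
move=> kK mk.
have mv i : (i < ck k)%N -> measurable_rV (v i : pastT k -> _).
  by rewrite checkpoint_id// => ik; apply: measurable_v => //; exact: leq_trans (ltnW ik) kK.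
have -> : [set w | N k w = n] = \bigcup_(z in [set z : int | maxn 1 `|z|%N = n])
    ((fun w : pastT k => Num.ceil (alpha * sigma ^+ 2 / batch_den k w)) @^-1` [set z]).
  apply/seteqP; split => [w /= Nw|w [z /= zn wz]]; last by rewrite -zn -wz.
  by exists (Num.ceil (alpha * sigma ^+ 2 / batch_den k w)).
rewrite bigcup_mkcond; apply: countable_bigcupT_measurable => [|z].
  exact: countableP.
by case: ifP => _; [exact: measurable_ceil_batch|exact: measurable0].
Qed.

(** The batch size is random but determined by the past, so the events [N = n] are
    treated separately: on each of them the average of [n] samples has variance
    at most [sigma^2 / n]. *)
Lemma checkpoint_error k : (k <= K)%N -> (m %| k)%N ->
  (\int[P]_w (enorm (err k w) ^+ 2)%:E <= \int[P]_w (batch_den k w / alpha)%:E)%E.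
Proof.
move=> kK mk.
have mE n := measurable_batch_event n kK mk.
have mv i : (i < ck k)%N -> measurable_rV (v i : pastT k -> _).
  by rewrite checkpoint_id// => ik; apply: measurable_v => //; exact: leq_trans (ltnW ik) kK.
have mden : measurable_fun [set: Omega] (batch_den k).
  by apply: (measurableT_comp (measurable_batch_den mv) (@measurable_id_past k)).
have mden' : measurable_fun [set: Omega] (fun w => batch_den k w / alpha).
  exact: measurable_funM.
have den0 w : 0 <= batch_den k w / alpha.
  by rewrite divr_ge0// ltW// batch_den_gt0.
apply: (@ge0_le_integral_partition _ _ _ _ (fun n => [set w | N k w = n])) => //.
- by move=> n; exact: measurable_past (mE n).
- by apply/trivIsetP => i j _ _ ij; apply/seteqP; split => w //= [wi wj];
    move: ij; rewrite -wi -wj eqxx.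
- by apply/seteqP; split => w //= _; exists (N k w).
- exact: measurable_sqr_err.
- by move=> w; exact: sqr_ge0.
move=> n; have [->|n0] := posnP n.
  have -> : [set w | N k w = 0%N] = set0.
    apply/seteqP; split => w //= w0.
    by have := adaptive_batch_gt0 k w; rewrite w0.
  by rewrite !integral_set0.
pose kK1 := leqW kK.
pose phi (z : pastT k * traj M) := g z.2 (theta k z.1) - grad J (theta k z.1).
have mth : measurable_rV (fun z : pastT k * traj M => theta k z.1).
  by move=> c; apply: (measurableT_comp (measurable_theta kK1 (leqnn k) c)).
have := @conditional_variance_rV_le _ _ _ Omega (pastT k) (traj M) R d P id
  [set w | N k w = n] (step_ker kK1) n (fun i => tau k i) (@measurable_id_past k) (mE n)
  _ _ phi (fun=> 0) (fun=> sigma ^+ 2) _ _ _ _ _ n0.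
move=> H.
apply: (@le_trans _ _ (\int[P]_(w in [set w | N k w = n])
   (n%:R^-1 * sigma ^+ 2 + enorm (0 : 'rV[R]_d) ^+ 2)%:E)%E); last first.
  apply: ge0_le_integral => //.
  - exact: measurable_past (mE n).
  - by move=> w _; rewrite lee_fin addr_ge0 ?sqr_ge0// mulr_ge0 ?sqr_ge0// invr_ge0.
  - by apply: measurable_funTS; exact/measurable_EFinP.
  - by move=> w <-; rewrite lee_fin enorm0_sqr addr0; exact: adaptive_batch_ge.
apply: le_trans (H _ _ _ _ _ _ _) => //.
- rewrite le_eqVlt; apply/orP; left; apply/eqP; apply: eq_integral => w; rewrite inE/= => Nw.
  rewrite /err (run_checkpoint hrun)// Nw addr0 /phi/=; congr ((enorm _ ^+ 2)%:E).
  rewrite sumrB sumr_const card_ord scalerBr; congr (_ - _).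
  by rewrite -(scaler_nat n (grad _ _)) scalerA mulVf ?scale1r// pnatr_eq0 -lt0n.
- by move=> i; exact: run_measurable hrun _ _.
- by apply: (step_ker_iid kK) => w; rewrite /batch mk.
- apply: measurable_rVB; first exact: (measurable_traj_grad_param hb hA2 hLg).
  exact: (measurable_grad_param hL).
- move=> x c; rewrite /phi/=; under eq_integral do rewrite coordB.
  apply: centered_mean; first exact: measurable_traj_grad.
  exact: mean_traj_grad.
- move=> x; have := hA3 (theta k x); rewrite unlock; exact.
Qed.

Lemma inner_step_mean x y c :
  (\int[p x]_t ((g t x - importance_weight pi t x y *: g t y) 0 c)%:E =
   ((grad J x - grad J y) 0 c)%:E)%E.
Proof.
have mgx := mean_traj_grad hA1 x c.
have mw := mean_weighted_traj_grad hb hA1 hA2 x y c.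
under eq_integral do rewrite coordB coordZ EFinB.
rewrite integralB_EFin// ?mgx ?mw ?coordB//.
- by apply: finite_integral_integrable mgx; exact: measurable_traj_grad.
- apply: finite_integral_integrable mw; apply: measurable_funM.
    exact: measurable_importance_weight.
  exact: measurable_traj_grad.
Qed.

(** The samples are centered at [grad J(theta_k) - grad J(snapshot)], so the error
    at [k] is their average deviation plus the error at the checkpoint, which is
    determined by the past. *)
Lemma inner_error k : (k <= K)%N -> ~~ (m %| k)%N ->
  (\int[P]_w (enorm (err k w) ^+ 2)%:E <=
   \int[P]_w (B%:R^-1 * (Q * enorm (theta k w - theta (ck k) w) ^+ 2)
               + enorm (err (ck k) w) ^+ 2)%:E)%E.
Proof.
move=> kK mk; have ckk := checkpoint_lt mk.
have ckK : (ck k <= K)%N by exact: leq_trans (ltnW ckk) kK.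
pose kK1 := leqW kK.
have mth : measurable_rV (theta k : pastT k -> _) by exact: measurable_theta.
have msn : measurable_rV (theta (ck k) : pastT k -> _).
  by apply: measurable_theta; [exact: leqW|exact: ltnW].
have fst_rV (f : pastT k -> 'rV[R]_d) : measurable_rV f ->
    measurable_rV (fun z : pastT k * traj M => f z.1).
  by move=> mf c; apply: (measurableT_comp (mf c)).
pose phi (z : pastT k * traj M) :=
  (g z.2 (theta k z.1) - importance_weight pi z.2 (theta k z.1) (theta (ck k) z.1)
     *: g z.2 (theta (ck k) z.1))
  - (grad J (theta k z.1) - grad J (theta (ck k) z.1)).
have mphi0 (X : measurableType _) (t : X -> traj M) (x y : X -> 'rV[R]_d) :
    measurable_fun setT t -> measurable_rV x -> measurable_rV y ->
    measurable_rV (fun z => g (t z) (x z) - importance_weight pi (t z) (x z) (y z) *: g (t z) (y z)).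
  move=> mt mx my c; under eq_fun do rewrite coordB coordZ.
  apply: measurable_funB; first exact: (measurable_traj_grad_param hb hA2 hLg).
  apply: measurable_funM; first exact: measurable_importance_weight_param.
  exact: (measurable_traj_grad_param hb hA2 hLg).
have H := @conditional_variance_rV_le _ _ _ Omega (pastT k) (traj M) R d P id
  setT (step_ker kK1) B (fun i => tau k i) (@measurable_id_past k) measurableT
  _ _ phi (err (ck k)) (fun w => Q * enorm (theta k w - theta (ck k) w) ^+ 2) _ _ _ _ _ B0.
apply: le_trans (H _ _ _ _ _ _ _) => //.
- rewrite preimage_setT le_eqVlt; apply/orP; left; apply/eqP; apply: eq_integral => w _.
  rewrite /err (run_inner hrun)// /phi/=; congr ((enorm _ ^+ 2)%:E).
  rewrite [in RHS]sumrB sumr_const card_ord scalerBr.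
  rewrite -(scaler_nat B (_ - _)) scalerA mulVf ?scale1r ?pnatr_eq0 -?lt0n//.
  by rewrite opprB [RHS]addrACA; congr (_ + _); rewrite addrAC subrr add0r.
- by move=> i; exact: (run_measurable hrun).
- by apply: (step_ker_iid kK) => w _; rewrite /batch (negbTE mk).
- apply: measurable_rVB; first by apply: mphi0 => //; exact: fst_rV.
  by apply: measurable_rVB; apply: (measurable_grad_param hL); exact: fst_rV.
- exact: measurable_err.
- by apply: measurable_funM => //; apply: measurable_sqr_enorm; exact: measurable_rVB.
- move=> x c; rewrite /phi/=; under eq_integral do rewrite coordB.
  apply: centered_mean; last exact: inner_step_mean.
  exact: mphi0.
- move=> x; rewrite /phi/=.
  apply: le_trans (weighted_difference_moment hb hA2 hLg hGamma halpha (theta k x) (theta (ck k) x)).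
  apply: centered_moment_rV_le; last exact: inner_step_mean.
  exact: mphi0.
Qed.

Lemma theta_drift j k w : (j <= k)%N -> (k <= K.+1)%N ->
  theta k w - theta j w = \sum_(j <= i < k) eta *: v i w.
Proof.
elim: k => [|k ih]; first by rewrite leqn0 => /eqP -> _; rewrite subrr big_geq.
rewrite leq_eqVlt => /predU1P[<- _|jk kK]; first by rewrite subrr big_geq.
rewrite big_nat_recr//= -ih//; last exact: ltnW.
by rewrite (run_update hrun)// addrAC.
Qed.

Lemma sqr_drift_le k w : (k <= K)%N ->
  enorm (theta k w - theta (ck k) w) ^+ 2 <=
  eta ^+ 2 * m%:R * \sum_(ck k <= i < k) enorm (v i w) ^+ 2.
Proof.
move=> kK; rewrite (theta_drift _ (checkpoint_le k) (leqW kK)).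
apply: (le_trans (sqr_enorm_sum_le _ _)).
under eq_bigr do rewrite sqr_enormZ.
rewrite -mulr_sumr mulrA (mulrC (eta ^+ 2)).
apply: ler_wpM2r; first by apply: sumr_ge0 => i _; exact: sqr_ge0.
apply: ler_wpM2r; first exact: sqr_ge0.
by rewrite ler_nat size_iota /checkpoint {1}(divn_eq k m) addKn ltnW// ltn_mod.
Qed.

Lemma Gamma_ge0 : 0 <= Gamma.
Proof. exact: le_trans (sqr_ge0 _) (hGamma (point : traj M) 0). Qed.

Lemma Qconst_ge0 : 0 <= Q.
Proof.
rewrite /Qconst mulr_ge0// addr_ge0 ?sqr_ge0// mulr_ge0 ?Gamma_ge0//.
exact: ltW.
Qed.

Definition mean_sqr_dir k := (\int[P]_w (enorm (v k w) ^+ 2)%:E)%E.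
Definition mean_sqr_err k := (\int[P]_w (enorm (err k w) ^+ 2)%:E)%E.

Lemma ge0_integral_affine (s : seq nat) (f : nat -> Omega -> R) (c r : R) :
  0 <= c -> 0 <= r -> (forall i w, 0 <= f i w) ->
  (forall i, i \in s -> measurable_fun setT (f i)) ->
  (forall i, i \in s -> \int[P]_w (f i w)%:E < +oo)%E ->
  (\int[P]_w (c * (\sum_(i <- s) f i w) + r)%:E =
   (c * (\sum_(i <- s) fine (\int[P]_w (f i w)%:E)) + r)%:E)%E.
Proof.
move=> c0 r0 f0; elim: s => [|i s ih] mf foo.
  rewrite big_nil mulr0 add0r; under eq_integral do rewrite big_nil mulr0 add0r.
  exact: integral_probability_cst.
have mfs j : j \in s -> measurable_fun setT (f j).
  by move=> js; apply: mf; rewrite in_cons js orbT.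
have msum : measurable_fun setT (fun w => c * (\sum_(j <- s) f j w) + r).
  apply: measurable_funD => //; apply: measurable_funM => //.
  elim: s {ih mf foo} mfs => [|j s ih] mfs.
    by under eq_fun do rewrite big_nil; exact: measurable_cst.
  under eq_fun do rewrite big_cons; apply: measurable_funD.
    by apply: mfs; rewrite mem_head.
  by apply: ih => l ls; apply: mfs; rewrite in_cons ls orbT.
have mfi : measurable_fun setT (f i) by apply: mf; rewrite mem_head.
have fioo : (\int[P]_w (f i w)%:E < +oo)%E by apply: foo; rewrite mem_head.
under eq_integral do rewrite big_cons mulrDr -addrA EFinD EFinM.
rewrite ge0_integralD//; last 4 first.
- by move=> w _; rewrite -EFinM lee_fin mulr_ge0.
- by apply: measurable_funeM; exact/measurable_EFinP.
- by move=> w _; rewrite lee_fin addr_ge0// mulr_ge0// sumr_ge0.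
- exact/measurable_EFinP.
rewrite ge0_integralZl//; last 2 first.
- exact/measurable_EFinP.
- by move=> w _; rewrite lee_fin.
rewrite ih//; last by move=> j js; apply: foo; rewrite in_cons js orbT.
rewrite big_cons mulrDr -addrA [in RHS]EFinD [in RHS]EFinM fineK//.
by rewrite ge0_fin_numE// integral_ge0// => w _; rewrite lee_fin.
Qed.

Lemma mean_sqr_err_checkpoint_le k : (k <= K)%N -> (m %| k)%N ->
  (forall i, (i < k)%N -> mean_sqr_dir i < +oo)%E ->
  (mean_sqr_err k <= (beta / m%:R / alpha * (\sum_(ck k - m <= i < ck k) fine (mean_sqr_dir i))
             + eps / alpha)%:E)%E.
Proof.
move=> kK mk voo; apply: (le_trans (checkpoint_error kK mk)).
have lt i : i \in index_iota (ck k - m) (ck k) -> (i < k)%N.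
  by rewrite checkpoint_id// mem_index_iota => /andP[].
rewrite -(@ge0_integral_affine _ (fun i w => enorm (v i w) ^+ 2)).
- rewrite le_eqVlt; apply/orP; left; apply/eqP; apply: eq_integral => w _.
  by congr (_%:E); rewrite /batch_den mulrDl; congr (_ + _); rewrite mulrAC.
- by rewrite !divr_ge0// ltW.
- by rewrite divr_ge0// ltW.
- by move=> i w; exact: sqr_ge0.
- by move=> i /lt ik; apply: measurable_sqr_v; exact: leq_trans (ltnW ik) kK.
- by move=> i /lt ik; exact: voo.
Qed.

Lemma mean_sqr_err_inner_le k : (k <= K)%N -> ~~ (m %| k)%N ->
  (forall i, (i < k)%N -> mean_sqr_dir i < +oo)%E -> (mean_sqr_err (ck k) < +oo)%E ->
  (mean_sqr_err k <= (eta ^+ 2 * m%:R * Q / B%:R * (\sum_(ck k <= i < k) fine (mean_sqr_dir i))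
             + fine (mean_sqr_err (ck k)))%:E)%E.
Proof.
move=> kK mk voo eoo; apply: (le_trans (inner_error kK mk)).
have ckk := checkpoint_lt mk.
have ckK : (ck k <= K)%N by exact: leq_trans (ltnW ckk) kK.
set c := eta ^+ 2 * m%:R * Q / B%:R.
have c0 : 0 <= c by rewrite divr_ge0// mulr_ge0 ?Qconst_ge0// mulr_ge0// sqr_ge0.
have lt i : i \in index_iota (ck k) k -> (i < k)%N.
  by rewrite mem_index_iota => /andP[].
have mve i : i \in index_iota (ck k) k -> measurable_fun [set: Omega] (fun w => enorm (v i w) ^+ 2).
  by move=> /lt ik; apply: measurable_sqr_v; exact: leq_trans (ltnW ik) kK.
have mean_sqr_err' := measurable_sqr_err ckK.
have msum : measurable_fun [set: Omega]
    (fun w => c * (\sum_(ck k <= i < k) enorm (v i w) ^+ 2) + 0).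
  apply: measurable_funD => //; apply: measurable_funM => //.
  apply: (measurableT_comp (measurable_sqr_sum _) (@measurable_id_past k)).
  move=> i /lt ik; apply: measurable_v => //; exact: leq_trans (ltnW ik) kK.
apply: (@le_trans _ _ (\int[P]_w ((c * (\sum_(ck k <= i < k) enorm (v i w) ^+ 2) + 0)%:E
   + (enorm (err (ck k) w) ^+ 2)%:E))%E).
  apply: ge0_le_integral => //.
  - move=> w _; rewrite lee_fin addr_ge0 ?sqr_ge0// mulr_ge0 ?invr_ge0//.
    by rewrite mulr_ge0 ?Qconst_ge0// sqr_ge0.
  - apply/measurable_EFinP; apply: measurable_funD => //.
    apply: measurable_funM => //; apply: measurable_funM => //.
    apply: (@measurable_sqr_rV_past k).
    by apply: measurable_rVB; apply: measurable_theta => //; [exact: leqW|exact: leqW|exact: ltnW].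
  - by apply: emeasurable_funD; exact/measurable_EFinP.
  - move=> w _; rewrite -EFinD lee_fin addr0 lerD2r /c.
    set V := \sum_(_ <= i < _) _.
    have -> : eta ^+ 2 * m%:R * Q / B%:R * V = B%:R^-1 * (Q * (eta ^+ 2 * m%:R * V)) by ring.
    rewrite ler_wpM2l ?invr_ge0//; apply: ler_wpM2l; first exact: Qconst_ge0.
    exact: sqr_drift_le.
rewrite ge0_integralD//; last 4 first.
- move=> w _; rewrite lee_fin addr0 mulr_ge0//; apply: sumr_ge0 => i _; exact: sqr_ge0.
- exact/measurable_EFinP.
- by move=> w _; rewrite lee_fin sqr_ge0.
- exact/measurable_EFinP.
rewrite (@ge0_integral_affine _ (fun i w => enorm (v i w) ^+ 2))//; last 2 first.
- by move=> i w; exact: sqr_ge0.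
- by move=> i /lt; exact: voo.
rewrite addr0 EFinD leeD2l// fineK// ge0_fin_numE//.
by apply: integral_ge0 => w _; rewrite lee_fin sqr_ge0.
Qed.

Lemma mean_sqr_dir_le k : (k <= K)%N ->
  (mean_sqr_dir k <= 2%:E * mean_sqr_err k + (2 * (d%:R * Gamma))%:E)%E.
Proof.
move=> kK; have me := measurable_sqr_err kK.
have dG : 0 <= 2 * (d%:R * Gamma) by rewrite !mulr_ge0// Gamma_ge0.
apply: (@le_trans _ _ (\int[P]_w (2%:E * (enorm (err k w) ^+ 2)%:E + (2 * (d%:R * Gamma))%:E))%E).
  apply: ge0_le_integral => //.
  - by move=> w _; rewrite lee_fin sqr_ge0.
  - by apply/measurable_EFinP; exact: measurable_sqr_v.
  - by apply: emeasurable_funD => //; apply: measurable_funeM; exact/measurable_EFinP.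
  - move=> w _; rewrite -EFinM -EFinD lee_fin -[v k w](subrK (grad J (theta k w))).
    apply: (le_trans (sqr_enormD_le _ _)); rewrite lerD2l ler_wpM2l//.
    exact: (sqr_grad_le hb hA1 hA2 hGamma).
rewrite ge0_integralD//; last 2 first.
- by move=> w _; rewrite -EFinM lee_fin mulr_ge0// sqr_ge0.
- by apply: measurable_funeM; exact/measurable_EFinP.
rewrite integral_probability_cst ge0_integralZl//.
- exact/measurable_EFinP.
- by move=> w _; rewrite lee_fin sqr_ge0.
Qed.

(** By strong induction: the error at [k] is controlled by earlier directions and
    errors, and [grad J] is bounded. *)
Lemma second_moments_finite k : (k <= K)%N -> (mean_sqr_dir k < +oo)%E /\ (mean_sqr_err k < +oo)%E.
Proof.
elim/ltn_ind: k => k ih kK.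
have voo i : (i < k)%N -> (mean_sqr_dir i < +oo)%E.
  by move=> ik; have [] := ih i ik (leq_trans (ltnW ik) kK).
have eoo : (mean_sqr_err k < +oo)%E.
  have [mk|mk] := boolP (m %| k)%N.
    by apply: le_lt_trans (mean_sqr_err_checkpoint_le kK mk voo) _; rewrite ltry.
  have ckk := checkpoint_lt mk.
  have [_ ckoo] := ih _ ckk (leq_trans (ltnW ckk) kK).
  by apply: le_lt_trans (mean_sqr_err_inner_le kK mk voo ckoo) _; rewrite ltry.
split => //; apply: le_lt_trans (mean_sqr_dir_le kK) _.
by rewrite lte_add_pinfty ?ltry// lte_mul_pinfty.
Qed.

(** The step size makes the quadratic term of the ascent inequality half of
    the gain [eta/2 |v|^2], which leaves [eta/4 |v|^2]. *)
Lemma ascent_step k w : eta = 1 / (2 * L) -> (k <= K)%N ->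
  eta / 4 * enorm (v k w) ^+ 2 <=
  J (theta k.+1 w) - J (theta k w) + eta / 2 * enorm (err k w) ^+ 2.
Proof.
move=> etaE kK.
have eta0 : 0 < eta by rewrite etaE divr_gt0// mulr_gt0.
have := smooth_ascent (theta k w) (eta *: v k w) (ltW hL0) hA1.1 hL.
rewrite -(run_update hrun)// sqr_enormZ.
have -> : L / 2 * (eta ^+ 2 * enorm (v k w) ^+ 2) = eta / 4 * enorm (v k w) ^+ 2.
  by rewrite etaE; field; rewrite gt_eqF.
have : eta / 2 * enorm (v k w) ^+ 2 - eta / 2 * enorm (err k w) ^+ 2 <=
    \sum_(c < d) grad J (theta k w) 0 c * (eta *: v k w) 0 c.
  rewrite !sqr_enorm !mulr_sumr -sumrB ler_sum// => c _.
  rewrite /err coordB coordZ; move: (grad _ _ _ _) (v k w 0 c) => x y.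
  by have := mulr_ge0 (ltW eta0) (sqr_ge0 x); lra.
lra.
Qed.

(** The ascent inequality is summed before taking expectations, so that the
    telescoping needs no integrability of [J (theta k)]. *)
Lemma sum_mean_sqr_dir_le theta_star : eta = 1 / (2 * L) ->
  (forall x, J x <= J theta_star) ->
  eta / 4 * (\sum_(0 <= k < K.+1) fine (mean_sqr_dir k)) <=
  eta / 2 * (\sum_(0 <= k < K.+1) fine (mean_sqr_err k)) + (J theta_star - J theta0).
Proof.
move=> etaE hstar.
have eta0 : 0 < eta by rewrite etaE divr_gt0// mulr_gt0.
have le i : i \in index_iota 0 K.+1 -> (i <= K)%N by rewrite mem_index_iota ltnS.
rewrite -[leLHS]addr0 -lee_fin.
have hv : forall i, i \in index_iota 0 K.+1 -> measurable_fun [set: Omega] (fun w => enorm (v i w) ^+ 2).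
  by move=> i /le; exact: measurable_sqr_v.
have he : forall i, i \in index_iota 0 K.+1 -> measurable_fun [set: Omega] (fun w => enorm (err i w) ^+ 2).
  by move=> i /le; exact: measurable_sqr_err.
rewrite -(@ge0_integral_affine _ (fun i w => enorm (v i w) ^+ 2))//; last 3 first.
- by rewrite divr_ge0// ltW.
- by move=> i w; exact: sqr_ge0.
- by move=> i /le iK; have [] := second_moments_finite iK.
rewrite -(@ge0_integral_affine _ (fun i w => enorm (err i w) ^+ 2))//; last 4 first.
- by rewrite divr_ge0// ltW.
- by rewrite subr_ge0.
- by move=> i w; exact: sqr_ge0.
- by move=> i /le iK; have [] := second_moments_finite iK.
have msum (f : nat -> Omega -> R) (c r : R) : (forall i, i \in index_iota 0 K.+1 -> measurable_fun setT (f i)) ->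
    measurable_fun setT (fun w => c * (\sum_(0 <= i < K.+1) f i w) + r).
  move=> mf; apply: measurable_funD => //; apply: measurable_funM => //.
  rewrite /index_iota; move: mf; rewrite /index_iota; elim: (iota _ _) => [|j t ih] mf.
    by under eq_fun do rewrite big_nil; exact: measurable_cst.
  under eq_fun do rewrite big_cons; apply: measurable_funD.
    by apply: mf; rewrite mem_head.
  by apply: ih => l lt; apply: mf; rewrite in_cons lt orbT.
apply: ge0_le_integral => //.
- move=> w _; rewrite lee_fin addr0 mulr_ge0 ?divr_ge0 ?(ltW eta0)//.
  by apply: sumr_ge0 => i _; exact: sqr_ge0.
- by apply/measurable_EFinP; exact: msum.
- by apply/measurable_EFinP; exact: msum.
move=> w _; rewrite lee_fin addr0 !mulr_sumr.
have tele n : (n <= K.+1)%N ->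
    \sum_(0 <= k < n) eta / 4 * enorm (v k w) ^+ 2 <=
    \sum_(0 <= k < n) eta / 2 * enorm (err k w) ^+ 2 + (J (theta n w) - J (theta 0%N w)).
  elim: n => [|n ih] nK; first by rewrite !big_geq// subrr addr0.
  rewrite !big_nat_recr//=.
  have := ascent_step w etaE nK; have := ih (ltnW nK); lra.
apply: (le_trans (tele _ (leqnn _))); rewrite lerD2l lerB//.
by rewrite (run_init hrun).
Qed.

Definition mean_sqr_grad k := (\int[P]_w (enorm (grad J (theta k w)) ^+ 2)%:E)%E.

Lemma mean_sqr_grad_le k : (k <= K)%N -> (mean_sqr_grad k <= (2 * fine (mean_sqr_dir k) + 2 * fine (mean_sqr_err k))%:E)%E.
Proof.
move=> kK; have [voo eoo] := second_moments_finite kK.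
have mv := measurable_sqr_v kK; have me := measurable_sqr_err kK.
have fin (f : Omega -> R) : (forall w, 0 <= f w) -> (\int[P]_w (f w)%:E < +oo)%E ->
    (\int[P]_w (f w)%:E)%E \is a fin_num.
  by move=> f0 foo; rewrite ge0_fin_numE// integral_ge0// => w _; rewrite lee_fin.
rewrite EFinD !EFinM !fineK; last 2 first.
- by apply: fin eoo => w; exact: sqr_ge0.
- by apply: fin voo => w; exact: sqr_ge0.
rewrite /mean_sqr_dir /mean_sqr_err -!ge0_integralZl//; last 4 first.
- exact/measurable_EFinP.
- by move=> w _; rewrite lee_fin sqr_ge0.
- exact/measurable_EFinP.
- by move=> w _; rewrite lee_fin sqr_ge0.
rewrite -ge0_integralD//; last 4 first.
- by move=> w _; rewrite -EFinM lee_fin mulr_ge0// sqr_ge0.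
- by apply: measurable_funeM; exact/measurable_EFinP.
- by move=> w _; rewrite -EFinM lee_fin mulr_ge0// sqr_ge0.
- by apply: measurable_funeM; exact/measurable_EFinP.
apply: ge0_le_integral => //.
- by move=> w _; rewrite lee_fin sqr_ge0.
- apply/measurable_EFinP; apply: (@measurable_sqr_rV_past k).
  by apply: measurable_grad_theta => //; exact: leqW.
- apply: emeasurable_funD; apply: measurable_funeM; exact/measurable_EFinP.
- move=> w _; rewrite -!EFinM -EFinD lee_fin.
  have -> : grad J (theta k w) = v k w + (-1) *: err k w.
    by rewrite /err scaleN1r opprB addrC subrK.
  apply: (le_trans (sqr_enormD_le _ _)).
  by rewrite (sqr_enormZ (-1)) sqrrN expr1n mul1r.
Qed.

Variable xi : Omega -> nat.
Hypothesis hxi : uniform_output K P tau xi.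

(** Both sides are the integral of [f] against one measure on the
    sigma-algebra of the run, written as two different mixtures of point masses. *)
Lemma integral_uniform_output k (f : Omega -> R) : (k <= K)%N ->
  (forall w, 0 <= f w) -> measurable_fun setT (f : pastT K.+1 -> R) ->
  (\int[P]_w ((\1_(xi @^-1` [set k]) w : R)%:E * (f w)%:E) =
   (K.+1%:R^-1)%:E * \int[P]_w (f w)%:E)%E.
Proof.
move=> kK f0 mf; have [mxi _ uni] := hxi.
have mk : measurable (xi @^-1` [set k]) by rewrite -[_ @^-1` _]setTI; exact: mxi.
have mfO : measurable_fun [set: Omega] f.
  exact: (measurableT_comp mf (@measurable_id_past K.+1)).
have mI : measurable_fun [set: Omega] (\1_(xi @^-1` [set k]) : Omega -> R).
  exact: measurable_indic.
have K0 : 0 <= K.+1%:R^-1 :> R by rewrite invr_ge0.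
have id0 w : 0 <= (\1_(xi @^-1` [set k]) w : R) by [].
pose m1 (w : Omega) : {measure set (pastT K.+1) -> \bar R} := mscale (NngNum (id0 w)) (\d_ (w : pastT K.+1)).
pose m2 (w : Omega) : {measure set (pastT K.+1) -> \bar R} := mscale (NngNum K0) (\d_ (w : pastT K.+1)).
pose nu : {measure set (pastT K.+1) -> \bar R} :=
  mscale (NngNum K0) (kmix P (kdirac (@measurable_id_past K.+1))).
have mU (U : set (pastT K.+1)) : measurable U -> measurable_fun [set: Omega] (\1_U : Omega -> R).
  by move=> /measurable_past mU; exact: measurable_indic.
have indU (U : set (pastT K.+1)) : measurable U -> (\int[P]_w (\1_U w)%:E = P U)%E.
  by move=> /measurable_past mU'; rewrite integral_indic// setIT.
have nuE U : measurable U -> nu U = ((K.+1%:R^-1)%:E * P U)%E.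
  by move=> mU'; rewrite -(indU _ mU').
have E1 : (\int[nu]_w (f w)%:E = \int[P]_w \int[m1 w]_w' (f w')%:E)%E.
  apply: ge0_integral_mixture => [U mU'|U mU'|y|]; last 2 first.
  - by rewrite lee_fin.
  - exact/measurable_EFinP.
  - have -> : (m1 ^~ U) = (fun w => (\1_(xi @^-1` [set k]) w * \1_U w)%:E) by [].
    by apply/measurable_EFinP; apply: measurable_funM => //; exact: mU.
  - rewrite nuE// muleC -(uni k U kK mU').
    rewrite -[LHS](_ : (\int[P]_w (\1_(U `&` xi @^-1` [set k]) w)%:E)%E = _); last first.
      by rewrite integral_indic ?setIT//; apply: measurableI => //; exact: measurable_past mU'.
    by apply: eq_integral => w _; rewrite indicI/= mulrC.
have E2 : (\int[nu]_w (f w)%:E = \int[P]_w \int[m2 w]_w' (f w')%:E)%E.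
  apply: ge0_integral_mixture => [U mU'|U mU'|y|]; last 2 first.
  - by rewrite lee_fin.
  - exact/measurable_EFinP.
  - have -> : (m2 ^~ U) = (fun w => (K.+1%:R^-1 * \1_U w)%:E) by [].
    by apply/measurable_EFinP; apply: measurable_funM => //; exact: mU.
  - rewrite nuE// -(indU _ mU') -ge0_integralZl//.
    + by apply/measurable_EFinP; exact: mU.
have intm (w : Omega) (c : R) (c0 : 0 <= c) :
    (\int[mscale (NngNum c0) (\d_ (w : pastT K.+1))]_w' (f w')%:E = c%:E * (f w)%:E)%E.
  rewrite ge0_integral_mscale//; last 2 first.
  - exact/measurable_EFinP.
  - by move=> w' _; rewrite lee_fin.
  rewrite integral_dirac//; last exact/measurable_EFinP.
  by rewrite diracT mul1e.
transitivity (\int[nu]_w (f w)%:E)%E.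
  by rewrite E1; apply: eq_integral => w _; rewrite intm.
rewrite E2 -ge0_integralZl//; last 2 first.
- exact/measurable_EFinP.
- by move=> w _; rewrite lee_fin.
by apply: eq_integral => w _; rewrite intm.
Qed.

Lemma expectation_output :
  ('E_P[fun w => (enorm (grad J (theta (xi w) w)) ^+ 2)%R] =
   (K.+1%:R^-1)%:E * \sum_(0 <= k < K.+1) mean_sqr_grad k)%E.
Proof.
have [mxi xiK _] := hxi; rewrite unlock.
have ordK (k : 'I_K.+1) : (k <= K)%N by rewrite -ltnS.
have mg k : (k <= K)%N -> measurable_fun [set: pastT K.+1]
    (fun w => enorm (grad J (theta k w)) ^+ 2).
  move=> kK; apply: measurable_sqr_enorm.
  by apply: measurable_grad_theta; exact: leqW.
transitivity (\int[P]_w \sum_(k < K.+1)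
    ((\1_(xi @^-1` [set (k : nat)]) w : R)%:E * (enorm (grad J (theta k w)) ^+ 2)%:E))%E.
  apply: eq_integral => w _.
  have xw : (xi w < K.+1)%N by rewrite ltnS.
  rewrite (bigD1 (Ordinal xw))//= big1 ?adde0 => [|k kw].
    by rewrite indicE mem_set// mul1e.
  rewrite indicE memNset ?mul0e// => /= xk; move: kw; rewrite -(inj_eq val_inj)/= xk.
  by rewrite eqxx.
rewrite ge0_integral_sum//; last 2 first.
- move=> k; apply: emeasurable_funM; apply/measurable_EFinP.
    by apply: measurable_indic; rewrite -[_ @^-1` _]setTI; exact: mxi.
  exact: (measurableT_comp (mg k (ordK k)) (@measurable_id_past K.+1)).
- by move=> k w _; rewrite mule_ge0 ?lee_fin ?sqr_ge0.
rewrite big_mkord ge0_sume_distrr; last first.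
  by move=> k _; apply: integral_ge0 => w _; rewrite lee_fin sqr_ge0.
apply: eq_bigr => k _; apply: integral_uniform_output; first exact: ordK.
- by move=> w; exact: sqr_ge0.
- exact: mg (ordK k).
Qed.

End run.

(** * Summation over epochs and choice of the parameters *)

Section epoch_sums.
Context {R : realType}.

Lemma card_epoch_le m n q : (0 < m)%N ->
  \sum_(0 <= k < n | (k %/ m)%N == q) (1 : R) <= m%:R.
Proof.
move=> m0; rewrite big_mkord sumr_const ler_nat.
rewrite -[leqRHS]card_ord -(@card_in_imset _ _ (fun k : 'I_n => Ordinal (ltn_pmod k m0))).
  exact: max_card.
move=> i j /eqP iq /eqP jq [ij]; apply: val_inj => /=.
by rewrite (divn_eq i m) (divn_eq j m) iq jq ij.
Qed.

Lemma sub_range_sum_le (a : nat -> R) l u n (p : pred nat) :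
  (forall i, 0 <= a i) -> (u <= n)%N ->
  (forall i, (l <= i < u)%N -> p i) ->
  \sum_(l <= i < u) a i <= \sum_(0 <= i < n | p i) a i.
Proof.
move=> a0 un lup.
rewrite (big_nat_widenl l 0)// (big_nat_widen 0 u n)//.
rewrite big_mkcond [leRHS]big_mkcond ler_sum// => i _.
case: ifP => [h|_]; last by case: ifP.
by rewrite lup// h.
Qed.

(** Each index [i] is counted at most [m] times on either side: by the later
    indices of its own epoch, and by the indices of the next one. *)
Lemma epoch_sum_le (m K : nat) (a er : nat -> R) (c c' r : R) : (0 < m)%N ->
  (forall i, 0 <= a i) -> 0 <= c -> 0 <= c' ->
  (forall k, (k <= K)%N ->
    er k <= c * (\sum_(checkpoint m k <= i < k) a i)
      + c' * (\sum_(checkpoint m k - m <= i < checkpoint m k) a i) + r) ->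
  \sum_(0 <= k < K.+1) er k <=
    (c + c') * m%:R * (\sum_(0 <= k < K.+1) a k) + K.+1%:R * r.
Proof.
move=> m0 a0 c0 c'0 erle.
pose T q := \sum_(0 <= i < K.+1 | (i %/ m)%N == q) a i.
pose T' q := \sum_(0 <= i < K.+1 | ((i %/ m).+1)%N == q) a i.
have count (f : nat -> nat) :
    \sum_(0 <= k < K.+1) \sum_(0 <= i < K.+1 | f i == (k %/ m)%N) a i <=
    m%:R * \sum_(0 <= k < K.+1) a k.
  under eq_bigr do rewrite big_mkcond.
  rewrite exchange_big/= mulr_sumr ler_sum// => i _.
  under eq_bigr do rewrite eq_sym.
  rewrite -big_mkcond/=.
  apply: (@le_trans _ _ ((\sum_(0 <= k < K.+1 | (k %/ m)%N == f i) 1) * a i)).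
    by rewrite mulr_suml le_eqVlt; apply/orP; left; apply/eqP; apply: eq_bigr => k _; rewrite mul1r.
  by rewrite ler_wpM2r// card_epoch_le.
apply: (@le_trans _ _ (\sum_(0 <= k < K.+1) (c * T (k %/ m)%N + c' * T' (k %/ m)%N + r))).
  rewrite big_nat [leRHS]big_nat; apply: ler_sum => k; rewrite ltnS => kK.
  apply: (le_trans (erle k kK)); rewrite lerD2r lerD//.
    rewrite ler_wpM2l//; apply: sub_range_sum_le => // [|i /andP[ci ik]]; first exact: leqW.
    by rewrite eqn_leq leq_div2r ?(ltnW ik)//= -(mulnK (k %/ m) m0) leq_div2r.
  rewrite ler_wpM2l//; apply: sub_range_sum_le => // [|i /andP[ci ik]].
    by apply: leqW; exact: leq_trans (leq_trunc_div _ _) kK.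
  have q0 : (0 < k %/ m)%N.
    by move: ik; rewrite /checkpoint; case: (k %/ m)%N => //; rewrite mul0n.
  rewrite eqn_leq; apply/andP; split; first by rewrite ltn_divLR.
  have {}ci : ((k %/ m).-1 * m <= i)%N by rewrite -subn1 mulnBl mul1n.
  by rewrite -(prednK q0) ltnS -(mulnK (k %/ m).-1 m0) leq_div2r.
rewrite !big_split/= -!mulr_sumr.
rewrite sumr_const_nat subn0 mulr_natl lerD2r !mulrDl -!mulrA lerD//.
  by rewrite ler_wpM2l//; exact: (count (fun i => i %/ m)%N).
by rewrite ler_wpM2l//; exact: (count (fun i => (i %/ m).+1)%N).
Qed.

End epoch_sums.

Section parameter_choice.
Context {R : realType}.
Variables (L Lg Gamma alpha_w sigma eps : R).
Hypotheses (L0 : 0 < L) (eps0 : 0 < eps).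
Local Notation Q := (Qconst Lg Gamma alpha_w).
Local Notation m := (epoch_length L Lg Gamma alpha_w sigma eps).
Local Notation B := (inner_batch L Lg Gamma alpha_w sigma eps).

Lemma epoch_length_gt0 : (0 < m)%N.
Proof. by rewrite leq_max. Qed.

Lemma inner_batch_gt0 : (0 < B)%N.
Proof. by rewrite leq_max. Qed.

(** Before rounding both sides are equal; [m] is rounded down and [B] up. The
    exception is [m] raised to [1], which can break the inequality, but then every
    iteration is a checkpoint. *)
Lemma epoch_length_sqr_le : 0 <= Q -> m != 1%N -> Q * m%:R ^+ 2 <= L ^+ 2 * B%:R.
Proof.
rewrite /epoch_length /inner_batch; move: (Qconst Lg Gamma alpha_w) => q q0.
set x := L ^+ 2 * sigma ^+ 2 / (q * eps).
have x0 : 0 <= x.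
  by apply: divr_ge0; apply: mulr_ge0 => //; rewrite ?sqr_ge0// ltW.
have X0 : 0 <= x `^ (1 / 3) by exact: powR_ge0.
have [_|h _] := leqP (Num.truncn (x `^ (1 / 3))) 1; first by rewrite eqxx.
have mX : (Num.truncn (x `^ (1 / 3)))%:R <= x `^ (1 / 3) by rewrite truncn_le.
have X1 : 1 < x `^ (1 / 3).
  by apply: lt_le_trans mX; rewrite ltr1n.
have cube (z : R) : 0 <= z -> (z `^ (1 / 3)) ^+ 3 = z.
  by move=> z0; rewrite -powR_mulrn ?powR_ge0// -powRrM divfK// powRr1.
have xn0 : x != 0.
  by apply: contraTneq X1 => ->; rewrite powR0 ?ltr10// -leNgt.
have Qn0 : q != 0.
  by apply: contraNneq xn0; rewrite /x => ->; rewrite mul0r invr0 mulr0.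
have Qp : 0 < q by rewrite lt_def Qn0.
set y := q * sigma ^+ 4 / (L ^+ 2 * eps ^+ 2).
have y0 : 0 <= y.
  by apply: divr_ge0; apply: mulr_ge0; rewrite ?sqr_ge0// (exprM _ 2 2) sqr_ge0.
have YB : y `^ (1 / 3) <= (maxn 1 `|Num.ceil (y `^ (1 / 3))|%N)%:R.
  apply: (@le_trans _ _ (Num.ceil (y `^ (1 / 3)))%:~R); first exact: ceil_ge.
  apply: (@le_trans _ _ (`|Num.ceil (y `^ (1 / 3))|%N)%:R).
    by rewrite -[leRHS]mulrz_nat natz ler_int ler_norm.
  by rewrite ler_nat leq_maxr.
apply: (@le_trans _ _ (q * (x `^ (1 / 3)) ^+ 2)).
  by rewrite ler_wpM2l// ler_pXn2r// ?nnegrE.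
apply: (@le_trans _ _ (L ^+ 2 * y `^ (1 / 3))); last first.
  by rewrite ler_wpM2l// sqr_ge0.
set X := x `^ (1 / 3) in X0 *; set Y := y `^ (1 / 3).
have XE : X ^+ 3 = x by exact: cube.
have YE : Y ^+ 3 = y by exact: cube.
have Y0 : 0 <= Y by exact: powR_ge0.
rewrite -(ler_pXn2r (ltn0Sn 2)) ?nnegrE; last 2 first.
- by rewrite mulr_ge0// sqr_ge0.
- by rewrite mulr_ge0// sqr_ge0.
have -> : (q * X ^+ 2) ^+ 3 = q ^+ 3 * (X ^+ 3) ^+ 2 by ring.
have -> : (L ^+ 2 * Y) ^+ 3 = L ^+ 6 * Y ^+ 3 by ring.
rewrite XE YE le_eqVlt; apply/orP; left; apply/eqP; rewrite /x /y; field.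
by rewrite !gt_eqF.
Qed.

End parameter_choice.

(** * The convergence bound *)

Theorem theorem3 (R : realType)
    (d1 d2 : measure_display) (S : measurableType d1) (A : measurableType d2)
    (M : mdp S A R) (d : nat) (pi : policy S A R d)
    (e : estimator) (b : S * A -> R) (hb : measurable_fun setT b)
    (sigma L Lg Gamma alpha_w : R)
    (hA1 : unbiased M pi e b)
    (hA2 : bounded_log_derivatives M pi)
    (hA3 : bounded_variance M pi e b sigma)
    (hL0 : 0 < L) (hL : grad_lipschitz M pi L)
    (hLg : traj_grad_lipschitz M pi e b Lg)
    (hGamma : traj_grad_bounded M pi e b Gamma)
    (halpha0 : 0 < alpha_w) (halpha : weight_lipschitz M pi alpha_w)
    (theta_star : 'rV[R]_d)
    (hstar : forall theta, objective M pi theta <= objective M pi theta_star)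
    (eps : R) (heps : 0 < eps)
    (K : nat) (theta0 : 'rV[R]_d)
    (d3 : measure_display) (Omega : measurableType d3)
    (P : probability Omega R)
    (theta v : nat -> Omega -> 'rV[R]_d)
    (tau : nat -> nat -> Omega -> traj M)
    (hrun : abasvrpg_run pi e b sigma (1 / (2 * L)) eps 48 6
       (epoch_length L Lg Gamma alpha_w sigma eps)
       (inner_batch L Lg Gamma alpha_w sigma eps)
       K theta0 P theta v tau)
    (xi : Omega -> nat) (hxi : uniform_output K P tau xi) :
  ('E_P[fun w => (enorm (grad (objective M pi) (theta (xi w) w)) ^+ 2)%R] <=
   (88 * L / K.+1%:R * (objective M pi theta_star - objective M pi theta0)
    + eps / 2)%:E)%E.
Proof.
have Q0 := Qconst_ge0 Lg hGamma halpha0.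
have := epoch_length_sqr_le (sigma := sigma) hL0 heps Q0.
have := epoch_length_gt0 L Lg Gamma alpha_w sigma eps.
have := inner_batch_gt0 L Lg Gamma alpha_w sigma eps.
(* Only [mB] is used about the values of [m] and [B] from here on. *)
move: hrun; move: (epoch_length _ _ _ _ _ _) (inner_batch _ _ _ _ _ _) => m B.
have : 1 / (2 * L) = 1 / (2 * L) by [].
move: {1 3}(1 / (2 * L)) => eta etaE {}hrun B0 m0 mB.
have alpha0 : 0 < 48 :> R by [].
have beta0 : 0 <= 6 :> R by [].
pose V k := fine (mean_sqr_dir P v k).
pose D k := fine (mean_sqr_err M pi P theta v k).
have fin k (kK : (k <= K)%N) := second_moments_finite hb hA1 hA2 hA3 hL hLg hGamma
  halpha0 halpha heps alpha0 beta0 m0 B0 hrun kK.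
have V0 k : 0 <= V k.
  by apply: fine_ge0; apply: integral_ge0 => w _; rewrite lee_fin sqr_ge0.
have DE k : (k <= K)%N -> ((D k)%:E = mean_sqr_err M pi P theta v k)%E.
  move=> kK; rewrite fineK// ge0_fin_numE ?(fin k kK).2//.
  by apply: integral_ge0 => w _; rewrite lee_fin sqr_ge0.
(* For [m = 1] there is no drift from the checkpoint. *)
pose c : R := if m == 1%N then 0 else eta ^+ 2 * m%:R * Qconst Lg Gamma alpha_w / B%:R.
have c0 : 0 <= c.
  rewrite /c; case: ifP => // _.
  by rewrite divr_ge0// mulr_ge0// mulr_ge0// sqr_ge0.
have cm : c * m%:R <= 1 / 4.
  rewrite /c; case: eqP => [_|/eqP m1]; first by rewrite mul0r divr_ge0.
  have h := mB m1.
  rewrite mulrAC ler_pdivrMr ?ltr0n//.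
  have -> : eta ^+ 2 * m%:R * Qconst Lg Gamma alpha_w * m%:R =
      eta ^+ 2 * (Qconst Lg Gamma alpha_w * m%:R ^+ 2) by ring.
  have -> : 1 / 4 * B%:R = eta ^+ 2 * (L ^+ 2 * B%:R).
    by rewrite etaE; field; rewrite gt_eqF.
  by rewrite ler_wpM2l// sqr_ge0.
have DV k : (k <= K)%N ->
    D k <= c * (\sum_(checkpoint m k <= i < k) V i)
      + 6 / m%:R / 48 * (\sum_(checkpoint m k - m <= i < checkpoint m k) V i) + eps / 48.
  move=> kK.
  have voo j (i : nat) : (j <= k)%N -> (i < j)%N -> (mean_sqr_dir P v i < +oo)%E.
    move=> jk ij; have [] // := fin i _.
    by apply: ltnW; exact: leq_trans ij (leq_trans jk kK).
  have DC j : (j <= k)%N -> (m %| j)%N ->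
      D j <= 6 / m%:R / 48 * (\sum_(checkpoint m j - m <= i < checkpoint m j) V i) + eps / 48.
    move=> jk mj; have jK := leq_trans jk kK; rewrite -lee_fin DE//.
    apply: (mean_sqr_err_checkpoint_le hb hA1 hA2 hA3 hL hLg heps alpha0 beta0 hrun jK mj).
    by move=> i; exact: voo.
  have [mk|mk] := boolP (m %| k)%N.
    apply: (le_trans (DC k (leqnn k) mk)); rewrite -addrA lerDr mulr_ge0//.
    by apply: sumr_ge0.
  have m1 : m != 1%N by apply: contraNneq mk => ->; rewrite dvd1n.
  have ckk := checkpoint_lt mk.
  have ckK : (checkpoint m k <= K)%N := leq_trans (ltnW ckk) kK.
  have : D k <= c * (\sum_(checkpoint m k <= i < k) V i) + D (checkpoint m k).
    rewrite -lee_fin DE// /c (negbTE m1).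
    apply: (mean_sqr_err_inner_le hb hA1 hA2 hL hLg hGamma halpha0 halpha heps beta0 m0 B0 hrun kK mk).
      by move=> i; exact: voo.
    by have [] := fin _ ckK.
  move=> h; apply: (le_trans h); rewrite -addrA lerD2l.
  have := DC _ (ltnW ckk) (dvdn_checkpoint m k).
  by rewrite (checkpoint_id (dvdn_checkpoint m k)).
have c'0 : 0 <= 6 / m%:R / 48 :> R by rewrite !divr_ge0.
have := epoch_sum_le m0 V0 c0 c'0 DV.
have c'm : 6 / m%:R / 48 * m%:R = 1 / 8 :> R by field; rewrite pnatr_eq0 -lt0n.
rewrite mulrDl c'm.
set SV := \sum_(0 <= k < K.+1) V k; set SD := \sum_(0 <= k < K.+1) D k => SDle.
have SV0 : 0 <= SV by apply: sumr_ge0.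
have SVle := sum_mean_sqr_dir_le hb hA1 hA2 hA3 hL0 hL hLg hGamma halpha0 halpha heps
  alpha0 beta0 m0 B0 hrun etaE hstar.
rewrite -/SV -/SD in SVle.
rewrite (expectation_output hb hA2 hL hLg heps beta0 hrun hxi).
have K0 : 0 < K.+1%:R :> R by rewrite ltr0n.
apply: (@le_trans _ _ ((K.+1%:R^-1)%:E * (2 * SV + 2 * SD)%:E)%E).
  rewrite lee_wpmul2l ?lee_fin ?invr_ge0//.
  rewrite /SV /SD !mulr_sumr -big_split/= -sumEFin big_nat [leRHS]big_nat.
  apply: lee_sum => k; rewrite ltnS => kK.
  exact: (mean_sqr_grad_le hb hA1 hA2 hA3 hL hLg hGamma halpha0 halpha heps alpha0 beta0 m0 B0 hrun kK).
rewrite -EFinM lee_fin mulrC ler_pdivrMr//.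
set Delta := _ - _ in SVle *.
have -> : (88 * L / K.+1%:R * Delta + eps / 2) * K.+1%:R =
  88 * (L * Delta) + K.+1%:R * (eps / 2) by field; rewrite gt_eqF.
have SVle' : SV <= 2 * SD + 8 * (L * Delta).
  have : 8 * L * (eta / 4 * SV) <= 8 * L * (eta / 2 * SD + Delta).
    by rewrite ler_wpM2l// mulr_ge0// ltW.
  have -> : 8 * L * (eta / 4 * SV) = SV by rewrite etaE; field; rewrite gt_eqF.
  suff -> : 8 * L * (eta / 2 * SD + Delta) = 2 * SD + 8 * (L * Delta) by [].
  by rewrite etaE; field; rewrite gt_eqF.
have : (c * m%:R + 1 / 8) * SV <= 3 / 8 * SV.
  by rewrite ler_wpM2r//; lra.
have -> : K.+1%:R * (eps / 2) = 24 * (K.+1%:R * (eps / 48)) by field.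
lra.
Qed.
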